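(* Let $(\mathcal C,\delta)$ be a $C^*$-dynamical system with $\mathcal C\ne0$, and let $X$ be the maximal ideal space of $\mathcal C$, with $\mathcal C$ identified with $C(X)$. Let $A:\mathcal C\to\mathcal C$ be a transfer operator for $(\mathcal C,\delta)$. For $\psi\in\mathcal C$ with $\psi\ge0$ let $A\psi$ denote the operator $f\mapsto A(\psi f)$ on $\mathcal C$, and let $\ell(\psi)$ be the logarithm of the spectral radius of $A\psi$. Then $$\ell(\psi)=\max_{\mu\in M_\delta(\mathcal C)}\left(\int_X\ln\psi\,d\mu+\tau(\mu)\right),$$ where $\ln\psi$ is regarded as a function on $X$ and the functionals $\mu\in M_\delta(\mathcal C)$ are identified with regular Borel probability measures on $X$.
   Context: A base algebra $\mathcal C$ is the selfadjoint part $\{b\in\mathcal B: b^*=b\}$ of a commutative $C^*$-algebra $\mathcal B$ with identity $\mathbf 1$; via the Gelfand transform $\mathcal C\cong C(X)$, the real-valued continuous functions on the compact Hausdorff maximal ideal space $X$. A $C^*$-dynamical system is a pair $(\mathcal C,\delta)$ with $\mathcal C$ a base algebra and $\delta:\mathcal C\to\mathcal C$ an endomorphism with $\delta(\mathbf 1)=\mathbf 1$; such $\delta$ has the form $\delta f=f\circ\alpha$ for a unique continuous $\alpha:X\to X$, and $(X,\alpha)$ is the corresponding dynamical system. A linear operator $A:\mathcal C\to\mathcal C$ is a transfer operator for $(\mathcal C,\delta)$ if it is positive (maps nonnegative elements to nonnegative elements) and $A\bigl((\delta f)g\bigr)=fAg$ for all $f,g\in\mathcal C$. $\ell(\psi)=\lim_{n\to\infty}\frac1n\ln\|(A\psi)^n\|\in[-\infty,\infty)$,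 with $\ln0=-\infty$; the integral takes values in $[-\infty,\infty)$. $M(\mathcal C)$ is the set of positive linear functionals $\mu$ on $\mathcal C$ with $\mu(\mathbf 1)=1$; $M_\delta(\mathcal C)$ is the set of $\mu\in M(\mathcal C)$ with $\mu(\delta f)=\mu(f)$ for all $f\in\mathcal C$ (equivalently, $\alpha$-invariant regular Borel probability measures on $X$). A partition of unity in $\mathcal C$ is a finite set $D=\{g_1,\dots,g_k\}$ of nonnegative elements with $g_1+\dots+g_k=\mathbf 1$. For $\mu\in M_\delta(\mathcal C)$ the $t$-entropy is $$\tau(\mu):=\inf_{n\in\mathbb N}\frac{\tau_n(\mu)}{n},\qquad \tau_n(\mu):=\inf_D\tau_n(\mu,D),\qquad \tau_n(\mu,D):=\sup_{m\in M(\mathcal C)}\sum_{g\in D}\mu(g)\ln\frac{m(A^ng)}{\mu(g)},$$ the infimum being over all partitions of unity $D$ in $\mathcal C$; a summand with $\mu(g)=0$ is set to be zero regardless of $m(A^ng)$; and if for some $g\in D$ one has $A^ng=0$ and $\mu(g)>0$, then $\tau(\mu)=-\infty$ (consistently with $\ln0=-\infty$). *)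

(* Defs.v *)
From HB Require Import structures.
From mathcomp Require Import all_boot all_order all_algebra finmap.
From mathcomp Require Import all_classical all_reals all_analysis.

Set Implicit Arguments.
Unset Strict Implicit.
Unset Printing Implicit Defensive.

Import Order.TTheory GRing.Theory Num.Theory.
Import numFieldNormedType.Exports.

Local Open Scope classical_set_scope.
Local Open Scope ring_scope.

Notation "'C(' X , R )" := (continuousType X R)
  (at level 0, X at level 99, R at level 99, format "'C(' X ,  R )").

(* The library's [continuousType X R] with its pointwise structure of a
   commutative unital R-algebra. *)
Section algebra_of_continuous_functions.
Variables (X : ptopologicalType) (R : realType).

Definition cts : {pred X -> R} := mem [set f : X -> R | continuous f].

Let cts_rect (K : C(X, R) -> Type) :
  (forall f (Pf : f \in cts),
    K (mkcts (set_mem Pf : continuous f))) -> forall u, K u.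
Proof.
move=> Ksub u.
have Pu : (u : X -> R) \in cts by apply: mem_set; exact: cts_fun.
suff -> : u = mkcts (set_mem Pu : continuous (u : X -> R)) by exact: Ksub.
exact/continuousEP.
Qed.

HB.instance Definition _ :=
  @isSub.Build (X -> R) cts C(X, R) (fun f : C(X, R) => f : X -> R)
    (fun f (Pf : f \in cts) => mkcts (set_mem Pf : continuous f))
    cts_rect (fun _ _ => erefl).

Lemma cts_subring_closed : subring_closed cts.
Proof.
split=> [|f g /set_mem cf /set_mem cg|f g /set_mem cf /set_mem cg];
    apply: mem_set => /= x.
- exact: cvg_cst.
- by apply: cvgB; [exact: cf|exact: cg].
- by apply: cvgM; [exact: cf|exact: cg].
Qed.
HB.instance Definition _ := GRing.isSubringClosed.Build _ cts
  cts_subring_closed.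
HB.instance Definition _ := [SubChoice_isSubComNzRing of C(X, R) by <:].

Lemma cts_scaler_closed : GRing.scaler_closed cts.
Proof.
move=> a f /set_mem cf; apply: mem_set => /= x.
by apply: cvgM; [exact: cvg_cst|exact: cf].
Qed.
HB.instance Definition _ := GRing.isScaleClosed.Build R (X -> R) cts
  cts_scaler_closed.
HB.instance Definition _ := [SubZmodule_isSubLmodule of C(X, R) by <:].

Lemma cts_scalerAl (a : R) (f g : C(X, R)) : a *: (f * g) = a *: f * g.
Proof. by apply/continuousEP => x; exact: mulrA. Qed.
HB.instance Definition _ := GRing.Lmodule_isLalgebra.Build R C(X, R)
  cts_scalerAl.

End algebra_of_continuous_functions.

Section t_entropy.
Variables (X : ptopologicalType) (R : realType).
Implicit Types (f g psi : C(X, R)) (T A : C(X, R) -> C(X, R)).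

Definition nonneg f := forall x, 0 <= f x.

Definition transfer_operator (delta : C(X, R) -> C(X, R)) A :=
  (forall f, nonneg f -> nonneg (A f)) /\
  (forall f g, A (delta f * g) = f * A g).

Definition weighted A psi : C(X, R) -> C(X, R) := fun f => A (psi * f).

Definition cnorm f : \bar R := ereal_sup [set `|f x|%:E | x in [set: X]].

Definition opnorm T : \bar R :=
  ereal_sup [set cnorm (T f) | f in [set f | (cnorm f <= 1)%E]].

Definition log_spectral_radius T : \bar R :=
  limn (fun n => (n%:R^-1)%:E * lne (opnorm (iter n T)))%E.

Definition states : set {scalar C(X, R)} :=
  [set mu | (forall f, nonneg f -> 0 <= mu f) /\ mu 1 = 1].

Definition invariant_states (delta : C(X, R) -> C(X, R)) :
    set {scalar C(X, R)} :=
  [set mu | states mu /\ forall f, mu (delta f) = mu f].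

Definition partition_of_unity (D : {fset C(X, R)}) :=
  (forall g, g \in D -> nonneg g) /\ \sum_(g <- D) g = 1.

Local Open Scope ereal_scope.

(* [lne] is [-oo] at 0, and a sum of extended reals whose terms are all
   [< +oo] is [-oo] as soon as one of the terms is. *)
Definition tau_nD A (n : nat) (mu : {scalar C(X, R)}) (D : {fset C(X, R)}) :
    \bar R :=
  ereal_sup [set \sum_(g <- D)
      (if mu g == 0%R then 0
       else (mu g)%:E * lne (m (iter n A g) / mu g)%:E)
    | m in states].

Definition tau_n A (n : nat) (mu : {scalar C(X, R)}) : \bar R :=
  ereal_inf [set tau_nD A n mu D | D in partition_of_unity].

Definition t_entropy A (mu : {scalar C(X, R)}) : \bar R :=
  ereal_inf [set (n%:R^-1)%:E * tau_n A n mu | n in [set n | (0 < n)%N]].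

Definition borel := g_sigma_algebraType (@open X).

Definition regular_measure (P : probability borel R) :=
  forall B : set borel, measurable B ->
    P B = ereal_inf [set P U | U in [set U : set X | open U /\ B `<=` U]] /\
    P B = ereal_sup [set P K | K in [set K : set X | compact K /\ K `<=` B]].

Definition represents (P : probability borel R) (mu : {scalar C(X, R)}) :=
  regular_measure P /\ forall f, (mu f)%:E = \int[P]_x (f x)%:E.

(* For [X] compact Hausdorff and [mu] in [states], the Riesz representation
   theorem says that exactly one measure represents [mu]. *)
Definition riesz_measure (mu : {scalar C(X, R)}) : probability borel R :=
  get [set P | represents P mu].

Definition integral_ln psi (mu : {scalar C(X, R)}) : \bar R :=
  \int[riesz_measure mu]_x lne (psi x)%:E.

End t_entropy.

Definition is_max (R : realType) (S : set (\bar R)) (v : \bar R) :=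
  S v /\ ubound S v.

(* Main.v *)
(* The n-th power of the weighted operator is (A psi)^n f = A^n (psi_n f), where
   psi_n is the product of the delta^i psi, i < n; hence, by submultiplicativity
   (Fekete), l(psi) is the infimum over n >= 1 of ln (max A^n psi_n) / n.

   Upper bound. Replace psi by psi + eps = e^phi, with Birkhoff sums S_n phi. On a
   partition of unity so fine that S_n phi is almost constant on the support of
   each member, the tangent inequality ln y <= y w - 1 - ln w bounds tau_n(mu) by
   ln (max A^n e^(S_n phi)) - n mu(phi). Then let eps tend to 0.

   Attainment. Let x_n be a maximum point of A^n psi_n, nu_n the state
   f |-> A^n (psi_n f)(x_n) / A^n psi_n (x_n), and mu an ultrafilter limit of the
   averages of the nu_n o delta^i, i < n; it is invariant. If A^n e^theta <= 1, then
   Jensen's inequality for nu_n on blocks of length n gives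
   mu(theta) <= n (mu(phi) - l(psi)) whenever psi <= e^phi. Conversely, the first
   order condition at a state m maximising sum_g mu(g) ln m(A^n g) provides, for
   every partition of unity D, an h = e^theta, a combination of the members of D,
   with A^n h <= 1 and mu(theta) >= - tau_n(mu, D), up to a small perturbation.
   Together, tau(mu) >= l(psi) - mu(phi), and ln psi is the infimum of the phi.

   The functional calculus delta (u o f) = u o (delta f) is proved directly, without
   the underlying map of X, and the representing measure is built from the outer
   measure associated with the content U |-> sup {mu f | 0 <= f <= 1_U}. *)
Require Import Defs.
From HB Require Import structures.
From mathcomp Require Import all_boot all_order all_algebra finmap.
From mathcomp Require Import all_classical all_reals all_analysis.
From mathcomp Require Import measurable_realfun.
From mathcomp Require Import ring lra.
Import Order.TTheory GRing.Theory Num.Theory.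
Import numFieldNormedType.Exports.

Set Implicit Arguments.
Unset Strict Implicit.
Unset Printing Implicit Defensive.

Local Open Scope classical_set_scope.
Local Open Scope ring_scope.

(** * The algebra of continuous functions *)

Section continuous_functions.
Variables (X : ptopologicalType) (R : realType).
Implicit Types (f g : C(X, R)) (x : X).

Lemma ctsE : (forall f g x, (f + g) x = f x + g x) *
  (forall f g x, (f * g) x = f x * g x) * (forall f x, (- f) x = - f x) *
  (forall (a : R) f x, (a *: f) x = a * f x) *
  (forall x, (1 : C(X, R)) x = 1) * (forall x, (0 : C(X, R)) x = 0).
Proof. by do !split. Qed.

Lemma cts_sumE (I : Type) (s : seq I) (P : pred I) (F : I -> C(X, R)) x :
  (\sum_(i <- s | P i) F i) x = \sum_(i <- s | P i) F i x.
Proof. by elim/big_rec2: _ => [//|i y f _ <-]; rewrite ctsE. Qed.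

Lemma cts_prodE (I : Type) (s : seq I) (P : pred I) (F : I -> C(X, R)) x :
  (\prod_(i <- s | P i) F i) x = \prod_(i <- s | P i) F i x.
Proof. by elim/big_rec2: _ => [//|i y f _ <-]; rewrite ctsE. Qed.

Lemma ctsP f g : (forall x, f x = g x) -> f = g.
Proof. by move=> fg; exact/continuousEP. Qed.

Definition cts_comp f (u : R -> R) (cu : continuous u) : C(X, R) :=
  mkcts (fun x => continuous_comp (@cts_fun _ _ f x) (cu (f x))).

Lemma cts_compE f u (cu : continuous u) x : cts_comp f cu x = u (f x).
Proof. by []. Qed.

Definition cexp f : C(X, R) := cts_comp f (@continuous_expR R).
Definition cabs f : C(X, R) := cts_comp f (@norm_continuous R R).

Lemma cexpE f x : cexp f x = expR (f x). Proof. by []. Qed.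

Lemma cabsE f x : cabs f x = `|f x|. Proof. by []. Qed.

Lemma exists_cln f : (forall x, 0 < f x) -> exists h, cexp h = f.
Proof.
move=> f0.
have cl : continuous (fun x => ln (f x)).
  move=> x; apply: (@continuous_comp _ _ _ f (@ln R)); first exact: cts_fun.
  exact: continuous_ln.
exists (mkcts cl : C(X, R)); apply: ctsP => x.
by rewrite cts_compE /mkcts lnK// posrE.
Qed.

End continuous_functions.

Lemma scalar_of (R : pzRingType) (V : lmodType R) (f : V -> R) :
  scalar f -> exists mu : {scalar V}, forall v, mu v = f v.
Proof.
move=> lf; pose mu : {scalar V} := HB.pack f (GRing.isLinear.Build R V R^o _ f lf).
by exists mu.
Qed.

Section iterates.
Variables (R : pzRingType) (V : lmodType R) (f : {linear V -> V}).

Fact iter_linear n : linear (iter n f).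
Proof.
elim: n => [//|n IH] a u v; have := IH a u v; rewrite /= => ->; exact: linearP.
Qed.

HB.instance Definition _ n := GRing.isLinear.Build R V V _ (iter n f) (iter_linear n).
End iterates.

Section morphism_iterates.
Variables (R : pzRingType) (A : lalgType R) (f : {lrmorphism A -> A}).

Fact iter_monoid_morphism n : monoid_morphism (iter n f).
Proof.
split; elim: n => [//|n IH].
  by rewrite /= (_ : iter n f 1 = 1) ?rmorph1.
by move=> x y; have := IH x y; rewrite /= => ->; exact: rmorphM.
Qed.

HB.instance Definition _ n :=
  GRing.isMonoidMorphism.Build A A (iter n f) (iter_monoid_morphism n).
End morphism_iterates.

(** * Positive operators, states, and Jensen's inequality *)

Section positivity.
Variables (X : ptopologicalType) (R : realType).
Implicit Types (f g : C(X, R)) (x : X).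

Lemma nonneg_cexp f : nonneg (cexp f).
Proof. by move=> x; exact: expR_ge0. Qed.

Lemma nonneg_mul f g : nonneg f -> nonneg g -> nonneg (f * g).
Proof. by move=> f0 g0 x; rewrite ctsE mulr_ge0. Qed.

Lemma nonneg_prod (I : Type) (s : seq I) (P : pred I) (F : I -> C(X, R)) :
  (forall i, P i -> nonneg (F i)) -> nonneg (\prod_(i <- s | P i) F i).
Proof. by move=> F0 x; rewrite cts_prodE; apply: prodr_ge0 => i Pi; exact: F0. Qed.

Lemma cexpD f g : cexp (f + g) = cexp f * cexp g.
Proof. by apply: ctsP => x; rewrite !(ctsE, cts_compE) expRD. Qed.

Lemma cexp_sum (I : Type) (s : seq I) (P : pred I) (F : I -> C(X, R)) :
  cexp (\sum_(i <- s | P i) F i) = \prod_(i <- s | P i) cexp (F i).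
Proof.
apply: ctsP => x; rewrite cts_compE cts_sumE cts_prodE expR_sum.
by apply: eq_bigr.
Qed.

Lemma nonneg_homo (T : {linear C(X, R) -> C(X, R)}) :
  (forall f, nonneg f -> nonneg (T f)) ->
  forall f g, (forall x, f x <= g x) -> forall x, T f x <= T g x.
Proof.
move=> T0 f g fg x; rewrite -subr_ge0.
have -> : T g x - T f x = T (g - f) x by rewrite linearB !ctsE.
by apply: T0 => y; rewrite !ctsE subr_ge0.
Qed.

Lemma iter_nonneg (T : C(X, R) -> C(X, R)) :
  (forall f, nonneg f -> nonneg (T f)) ->
  forall n f, nonneg f -> nonneg (iter n T f).
Proof. by move=> T0 n f f0; elim: n => //= n; exact: T0. Qed.

Lemma state_le (mu : {scalar C(X, R)}) f g : states mu ->
  (forall x, f x <= g x) -> mu f <= mu g.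
Proof.
move=> [mu0 _] fg; rewrite -subr_ge0 -linearB; apply: mu0 => x.
by rewrite !ctsE subr_ge0.
Qed.

Lemma state_cst (mu : {scalar C(X, R)}) (c : R) : states mu -> mu (c *: 1) = c.
Proof. by move=> [_ mu1]; rewrite linearZ/= mu1; exact: mulr1. Qed.

Lemma state_norm_le (mu : {scalar C(X, R)}) f (b : R) : states mu ->
  (forall x, `|f x| <= b) -> `|mu f| <= b.
Proof.
move=> mus fb; rewrite ler_norml -(state_cst b mus) -linearN /=.
apply/andP; split; apply: state_le => // x; rewrite !ctsE mulr1;
  by have := fb x; rewrite ler_norml => /andP[].
Qed.

Lemma expR_tangent (a t : R) : expR a * (1 + t - a) <= expR t.
Proof.
have -> : expR t = expR a * expR (t - a) by rewrite -expRD; congr expR; ring.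
by rewrite ler_wpM2l ?expR_ge0// -addrA expR_ge1Dx.
Qed.

(** The tangent to [expR] at [a = mu f] lies below the graph, and the mean under [mu] of its
    composite with [f] is [expR a]. *)
Lemma state_jensen_exp (mu : {scalar C(X, R)}) f : states mu ->
  expR (mu f) <= mu (cexp f).
Proof.
move=> mus; set a := mu f.
have -> : expR a = mu (expR a *: (((1 - a) *: 1 : C(X, R)) + f)).
  rewrite linearZ linearD /= (state_cst _ mus) -/a.
  by rewrite subrK; rewrite /GRing.scale /= mulr1.
apply: state_le => // x; rewrite !ctsE cts_compE; apply: le_trans (expR_tangent a _).
by rewrite ler_wpM2l ?expR_ge0//; lra.
Qed.

Lemma exists_eval_state x : exists mu : {scalar C(X, R)}, states mu /\
  forall f, mu f = f x.
Proof.
have [mu muE] : exists mu : {scalar C(X, R)}, forall f, mu f = f x.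
  by apply: scalar_of => a f g; rewrite !ctsE.
by exists mu; split => //; split=> [f f0|]; rewrite muE// ctsE.
Qed.

End positivity.

Section compactness.
Variables (X : ptopologicalType) (R : realType).
Hypothesis cptX : compact [set: X].
Implicit Types (f g : C(X, R)) (x : X).

Lemma cts_max f : exists x0, forall x, f x <= f x0.
Proof.
have [||c _ cmax] := @compact_EVT_max X R f [set: X] _ cptX.
- by exists point.
- by apply: continuous_subspaceT => x; exact: cts_fun.
by exists c => x; apply: cmax; rewrite in_setT.
Qed.

Lemma cts_bounded f : exists2 b, 0 <= b & forall x, `|f x| <= b.
Proof.
have [x0 x0P] := cts_max (cabs f).
by exists (cabs f x0) => [|x]; [exact: normr_ge0|exact: x0P].
Qed.

End compactness.

(** * Functional calculus and positivity for the endomorphism *)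

Section endomorphism.
Variables (X : ptopologicalType) (R : realType).
Variable delta : {lrmorphism C(X, R) -> C(X, R)}.
Implicit Types (f g : C(X, R)) (x : X).

Lemma endo_cst (a : R) : delta (a *: 1) = a *: 1.
Proof. by rewrite linearZ /= rmorph1. Qed.

(* If [g] vanished nowhere it would be invertible, and so would [delta g x = 0];
   at a zero [y] of [g] the functional [delta _ x] agrees with evaluation at [y]
   on both [f] and [u \o f]. *)
Lemma endo_comp f (u : R -> R) (cu : continuous u) :
  delta (cts_comp f cu) = cts_comp (delta f) cu.
Proof.
apply: ctsP => x; set c := delta f x; set c' := LHS.
pose g : C(X, R) := (f - c *: 1) ^+ 2 + (cts_comp f cu - c' *: 1) ^+ 2.
have gE y : g y = (f y - c) ^+ 2 + (u (f y) - c') ^+ 2.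
  by rewrite /g !expr2 !ctsE !mulr1 cts_compE.
have dg0 : delta g x = 0.
  have -> : delta g = (delta f - c *: 1) ^+ 2 +
      (delta (cts_comp f cu) - c' *: 1) ^+ 2.
    by rewrite /g rmorphD !rmorphXn !rmorphB /= !endo_cst.
  by rewrite !expr2 !ctsE !mulr1 -/c -/c' !subrr !mulr0 addr0.
have [gn0|] := pselect (forall y, g y != 0).
  have ci : continuous (fun y => (g y)^-1).
    by move=> y; apply: cvgV => //; exact: cts_fun.
  pose k : C(X, R) := mkcts ci.
  have gk : g * k = 1 by apply: ctsP => y; rewrite !ctsE; exact: (mulfV (gn0 y)).
  have : delta (g * k) x = 1 by rewrite gk rmorph1 ctsE.
  by rewrite rmorphM ctsE dg0 mul0r => /esym/eqP; rewrite oner_eq0.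
move=> /existsNP[y /negP]; rewrite negbK gE.
rewrite paddr_eq0 ?sqr_ge0// !sqrf_eq0 !subr_eq0 => /andP[/eqP fy /eqP ufy].
by rewrite cts_compE -/c -fy ufy.
Qed.

Lemma endo_nonneg f : nonneg f -> nonneg (delta f).
Proof.
move=> f0; have -> : f = cabs f.
  by apply: ctsP => x; rewrite cts_compE ger0_norm.
by rewrite /cabs endo_comp => x; rewrite cts_compE.
Qed.

Lemma iter_endo_nonneg n f : nonneg f -> nonneg (iter n delta f).
Proof. exact: (iter_nonneg endo_nonneg). Qed.

Lemma iter_endo_cexp n f : iter n delta (cexp f) = cexp (iter n delta f).
Proof. by elim: n => //= n ->; exact: endo_comp. Qed.

(** The functions [b + f] and [b - f] are nonnegative; [delta] preserves positivity and
    constants. *)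
Lemma iter_endo_norm_le n f b :
  (forall x, `|f x| <= b) -> forall x, `|iter n delta f x| <= b.
Proof.
move=> fb x.
have cb (h : C(X, R)) : nonneg h -> 0 <= iter n delta h x.
  by move=> h0; exact: iter_endo_nonneg.
have n1 : iter n delta (b *: 1) x = b by rewrite linearZ/= rmorph1 !ctsE mulr1.
have := cb (b *: 1 - f); have := cb (b *: 1 + f).
rewrite linearD linearB /= !ctsE n1 => h1 h2.
have fb' y : - b <= f y <= b by rewrite -ler_norml.
have {}h1 : 0 <= b + iter n delta f x.
  by apply: h1 => y; rewrite !ctsE mulr1; have /andP[] := fb' y; lra.
have {}h2 : 0 <= b - iter n delta f x.
  by apply: h2 => y; rewrite !ctsE mulr1; have /andP[] := fb' y; lra.
by rewrite ler_norml; apply/andP; split; lra.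
Qed.

End endomorphism.

(** * Transfer operators and Birkhoff sums *)

Section transfer.
Variables (X : ptopologicalType) (R : realType).
Hypothesis cptX : compact [set: X].
Variables (delta : {lrmorphism C(X, R) -> C(X, R)}).
Variables (A : {linear C(X, R) -> C(X, R)}).
Hypothesis hA : transfer_operator delta A.
Implicit Types (f g phi theta psi : C(X, R)) (x : X).

Definition weight psi n : C(X, R) := \prod_(i < n) iter i delta psi.
Definition birkhoff f n : C(X, R) := \sum_(i < n) iter i delta f.

Lemma iter_transfer j f g : iter j A (iter j delta f * g) = f * iter j A g.
Proof.
elim: j f g => [//|j IH] f g.
by rewrite iterSr iterS hA.2 IH -iterSr.
Qed.

(** By the transfer identity, an outer factor [psi] enters [A^n] as [delta^n psi], the next factor
    of the weight. *)
Lemma iter_weighted psi n f :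
  iter n (weighted A psi) f = iter n A (weight psi n * f).
Proof.
elim: n => [|n IH]; first by rewrite /weight big_ord0 mul1r.
rewrite iterS IH /weighted -iter_transfer -iterS /weight big_ord_recr /=.
by rewrite mulrA [_ * iter n delta psi]mulrC.
Qed.

Lemma iter_transfer_le n f g : (forall x, f x <= g x) ->
  forall x, iter n A f x <= iter n A g x.
Proof. by move=> fg; apply: nonneg_homo => // h; exact: iter_nonneg hA.1 _ _. Qed.

Lemma nonneg_weight psi n : nonneg psi -> nonneg (weight psi n).
Proof. by move=> p0; apply: nonneg_prod => i _; exact: iter_endo_nonneg. Qed.

Lemma weight_cexp phi n : weight (cexp phi) n = cexp (birkhoff phi n).
Proof. by rewrite cexp_sum; apply: eq_bigr => i _; exact: iter_endo_cexp. Qed.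

Lemma weight_le psi1 psi2 n : nonneg psi1 -> (forall x, psi1 x <= psi2 x) ->
  forall x, weight psi1 n x <= weight psi2 n x.
Proof.
move=> p0 pp x; rewrite !cts_prodE; apply: ler_prod => i _.
rewrite iter_endo_nonneg//=; apply: nonneg_homo => // h.
exact: iter_endo_nonneg.
Qed.

(** As [A 1] need not be [1], the steps left over outside the blocks of length [n] cost a constant;
    at most [2n] such steps occur. *)
Lemma iter_transfer_bounded m :
  exists2 c, 1 <= c & forall i, (i <= m)%N -> forall x, iter i A 1 x <= c.
Proof.
elim: m => [|m [c c1 cP]].
  by exists 1 => // i; rewrite leqn0 => /eqP -> x; rewrite ctsE.
have [b b0 bP] := cts_bounded cptX (iter m.+1 A 1).
exists (c + b) => [|i]; first by rewrite ler_wpDr.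
rewrite leq_eqVlt ltnS => /predU1P[->|/cP h] x.
  by rewrite (le_trans (ler_norm _))// (le_trans (bP _))// lerDr (le_trans _ c1).
by rewrite ler_wpDr.
Qed.

(** Every index below [k * n] is [i + j * n] for exactly one [i < n] and one [j < k]. *)
Lemma birkhoff_block theta n k :
  \sum_(i < n) iter i delta (\sum_(j < k) iter (j * n) delta theta) =
  birkhoff theta (k * n).
Proof.
elim: k => [|k IH].
  rewrite mul0n /birkhoff [RHS]big_ord0 big1// => i _.
  by rewrite big_ord0 linear0.
under eq_bigr => i _ do rewrite big_ord_recr linearD/=.
rewrite big_split /= IH mulSn addnC /birkhoff big_split_ord /=; congr (_ + _).
by apply: eq_bigr => i _; rewrite -iterD addnC.
Qed.

(** The last block is [delta^(k n)] of [cexp theta], so [A^(k n)] lets it out unchanged. The factor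
    beside it is at most [1] by induction, and the remaining [A^n] acts on at most [cexp theta]. *)
Lemma iter_block_le1 theta n k : (forall x, iter n A (cexp theta) x <= 1) ->
  forall x, iter (k * n) A (cexp (\sum_(j < k) iter (j * n) delta theta)) x <= 1.
Proof.
move=> t1; elim: k => [|k IH] x.
  by rewrite mul0n big_ord0 /= cts_compE ctsE expR0.
rewrite big_ord_recr /= cexpD mulrC -iter_endo_cexp mulSn iterD iter_transfer.
apply: le_trans (t1 x); apply: iter_transfer_le => y.
by rewrite ctsE ler_piMr// nonneg_cexp.
Qed.

(* Jensen's inequality for [nu], applied to the [n] shifted copies of the
   product of [cexp theta] over blocks of length [n]. *)
Lemma gibbs_block_estimate psi phi theta n N (C b a : R) x0
    (nu : {scalar C(X, R)}) :
  nonneg psi -> (forall x, psi x <= cexp phi x) ->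
  (forall x, iter n A (cexp theta) x <= 1) -> (forall x, `|theta x| <= b) ->
  1 <= C -> (forall i, (i <= n.*2)%N -> forall x, iter i A 1 x <= C) ->
  (0 < n <= N)%N -> 0 < a -> states nu ->
  (forall f, nu f = iter N A (weight psi N * f) x0 / a) ->
  n%:R * ln a + nu (birkhoff theta N) - n%:R * nu (birkhoff phi N) <=
  n%:R * ln (C ^+ 2) + n.*2%:R * b.
Proof.
move=> psi0 psiphi t1 tb C1 CP /andP[n0 nN] a0 nus nuE.
have b0 : 0 <= b by exact: le_trans (normr_ge0 _) (tb x0).
(* One full block is held back, so that [n <= r <= 2n]: every shift [i < n] of the [k] blocks then
   still fits into [N] steps. *)
pose k := (N %/ n).-1; pose r := (N - k * n)%N.
have kN : (k * n <= N)%N.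
  by rewrite (leq_trans _ (leq_divM N n))// leq_mul2r leq_pred orbT.
have Nr : N = (r + k * n)%N by rewrite subnK.
have rn : (n <= r)%N.
  rewrite leq_subRL// -[X in (_ + X)%N]mul1n -mulnDl (leq_trans _ (leq_divM N n))//.
  by rewrite leq_mul2r addn1 prednK ?leqnn ?orbT// divn_gt0.
have r2n : (r <= n.*2)%N.
  rewrite leq_subLR {1}(divn_eq N n) -addnn addnA -mulSnr prednK ?divn_gt0//.
  by rewrite leq_add2l ltnW// ltn_pmod.
pose H := \sum_(j < k) iter (j * n) delta theta.
(* After Jensen's inequality, the weight of [psi] is cancelled by [exp (- S_N phi)] because
   [psi <= cexp phi]. *)
have step (i : 'I_n) : nu (iter i delta H) - nu (birkhoff phi N) <= ln (C ^+ 2) - ln a.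
  have C2 : 0 < C ^+ 2 by rewrite exprn_gt0// (lt_le_trans ltr01).
  rewrite -ln_div ?posrE// -ler_expR lnK ?posrE ?divr_gt0//.
  rewrite -linearB /=; apply: le_trans (state_jensen_exp _ nus) _.
  rewrite nuE ler_pM2r ?invr_gt0//.
  have ir : (i <= r)%N by rewrite (leq_trans _ rn)// ltnW.
  apply: (@le_trans _ _ (iter N A (cexp (iter i delta H)) x0)).
    apply: iter_transfer_le => y; rewrite cexpD !ctsE mulrCA ler_piMr ?nonneg_cexp//.
    apply: (@le_trans _ _ ((weight (cexp phi) N * cexp (- birkhoff phi N)) y)).
      by rewrite ctsE ler_wpM2r ?nonneg_cexp// weight_le.
    by rewrite weight_cexp -cexpD subrr !(ctsE, cts_compE) expR0.
  rewrite -iter_endo_cexp -[cexp H]mulr1 rmorphM rmorph1.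
  (* The innermost [A^i] undoes the shift at the cost of one factor [C], [A^(k n)] consumes the
     blocks, and the outer [A^(r - i)] costs the other [C]. *)
  have -> : N = (r - i + k * n + i)%N by rewrite addnAC subnK.
  rewrite iterD iter_transfer.
  have CiP : forall y, iter i A 1 y <= C by apply: CP; rewrite (leq_trans ir).
  apply: (@le_trans _ _ (iter (r - i + k * n) A (C *: cexp H) x0)).
    apply: iter_transfer_le => y; rewrite !ctsE mulrC ler_wpM2r ?nonneg_cexp//.
  rewrite linearZ /= ctsE expr2 ler_wpM2l//; first exact: le_trans C1.
  rewrite iterD.
  apply: (@le_trans _ _ (iter (r - i) A 1 x0)).
    apply: iter_transfer_le => y; rewrite ctsE; exact: iter_block_le1.
  by apply: CP; rewrite (leq_trans (leq_subr _ _)).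
have : \sum_(i < n) (nu (iter i delta H) - nu (birkhoff phi N)) <=
       \sum_(i < n) (ln (C ^+ 2) - ln a) by exact: ler_sum.
rewrite big_split /= -linear_sum /= birkhoff_block !sumr_const !card_ord.
rewrite -[X in _ + X <= _]mulr_natl -[X in _ <= X]mulr_natl => sumle.
(* The last [r <= 2n] terms of the Birkhoff sum lie outside the blocks; each is at most [b] in
   norm. *)
have : nu (birkhoff theta N) <= nu (birkhoff theta (k * n)) + n.*2%:R * b.
  have -> : birkhoff theta N = birkhoff theta (k * n) +
      \sum_(i < r) iter (k * n + i) delta theta.
    by rewrite Nr addnC /birkhoff big_split_ord.
  rewrite linearD lerD2l /= (le_trans (ler_norm _))//.
  apply: (@le_trans _ _ (r%:R * b)); last by rewrite ler_wpM2r// ler_nat.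
  rewrite linear_sum; apply: le_trans (ler_norm_sum _ _ _) _.
  rewrite mulr_natl -[X in _ *+ X](card_ord r) -sumr_const; apply: ler_sum => i _.
  by apply: state_norm_le => // y; exact: iter_endo_norm_le.
lra.
Qed.

End transfer.

(** * Equilibrium states *)

Section ultralimits.
Variable R : realType.

Lemma exists_ultra_infty : exists G : set_system nat, UltraFilter G /\ \oo `<=` G.
Proof. exact: ultraFilterLemma. Qed.

(** Compactness of [[- b, b]] gives a cluster point, and an ultrafilter converges to each of its
    cluster points. *)
Lemma ultra_bounded_cvg (G : set_system nat) (u : nat -> R) b : UltraFilter G ->
  (forall n, `|u n| <= b) -> cvg (u n @[n --> G]).
Proof.
move=> GU ub; have GP : ProperFilter G by exact: ultra_proper.
have Gb : (u @ G) `[- b, b]%classic.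
  by apply: nearW => n /=; rewrite in_itv/= -ler_norml.
have [p [_ clp]] := @segment_compact R (- b) b (u @ G) _ Gb.
apply/cvg_ex; exists p => V Vp.
have [//|GnV] := in_ultra_setVsetC (u @^-1` V) GU.
by have [y [/= ? ?]] := clp (~` V) V GnV Vp.
Qed.

Variable X : ptopologicalType.
Hypothesis cptX : compact [set: X].
Implicit Types f g : C(X, R).

(** This serves as weak-* compactness of the state space. [X] need not be metrizable, so
    subsequences might not do; a single ultrafilter handles all [f] at once. *)
Lemma state_ultralimit (G : set_system nat) (m : nat -> {scalar C(X, R)}) :
  UltraFilter G -> (forall n, states (m n)) ->
  exists2 mu, states mu & forall f, m n f @[n --> G] --> mu f.
Proof.
move=> GU ms; have GP : ProperFilter G by exact: ultra_proper.
have mc f : cvg (m n f @[n --> G]).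
  have [b _ fb] := cts_bounded cptX f.
  by apply: (ultra_bounded_cvg (b := b)) => // n; exact: state_norm_le.
have [mu muE] : exists mu : {scalar C(X, R)}, forall f,
    mu f = lim (m n f @[n --> G]).
  apply: scalar_of => a f g; apply/cvg_lim => //.
  under eq_cvg do rewrite linearP.
  by apply: cvgD; [apply: cvgMr; exact: mc|exact: mc].
have mcv f : m n f @[n --> G] --> mu f by rewrite muE; exact: mc.
exists mu => //; split=> [f f0|].
  apply: (ler_cvg_to (cvg_cst 0) (mcv f)); apply: nearW => n.
  exact: (ms n).1.
rewrite muE; apply/cvg_lim => //; under eq_cvg do rewrite (ms _).2.
exact: cvg_cst.
Qed.

End ultralimits.

(** * Construction of the equilibrium state *)

Section equilibrium.
Variables (X : ptopologicalType) (R : realType).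
Hypothesis cptX : compact [set: X].
Variables (delta : {lrmorphism C(X, R) -> C(X, R)}).
Variables (A : {linear C(X, R) -> C(X, R)}).
Hypothesis hA : transfer_operator delta A.
Implicit Types (f g phi theta psi : C(X, R)) (x : X).

Lemma birkhoff_linear n (a : R) f g :
  birkhoff delta (a *: f + g) n = a *: birkhoff delta f n + birkhoff delta g n.
Proof.
rewrite /birkhoff scaler_sumr -big_split /=; apply: eq_bigr => i _.
by rewrite linearP.
Qed.

Lemma birkhoff_endo f n :
  birkhoff delta (delta f) n + f = birkhoff delta f n + iter n delta f.
Proof.
transitivity (birkhoff delta f n.+1); rewrite /birkhoff.
  rewrite big_ord_recl addrC; congr (_ + _); apply: eq_bigr => i _.
  by rewrite -iterSr.
by rewrite big_ord_recr.
Qed.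

(** The Krylov-Bogolyubov argument: the averages of [delta f] and of [f] differ only by a boundary
    term that tends to zero. *)
Lemma birkhoff_average_limit (nu : nat -> {scalar C(X, R)}) (G : set_system nat) :
  UltraFilter G -> \oo `<=` G -> (forall n, states (nu n)) ->
  exists2 mu, invariant_states delta mu &
    forall f, n.+1%:R^-1 * nu n (birkhoff delta f n.+1) @[n --> G] --> mu f.
Proof.
move=> GU Goo nus; have GP : ProperFilter G by exact: ultra_proper.
have mE n : exists m : {scalar C(X, R)}, forall f,
    m f = n.+1%:R^-1 * nu n (birkhoff delta f n.+1).
  apply: scalar_of => a f g; rewrite birkhoff_linear linearP /=.
  by rewrite /GRing.scale/=; ring.
have [m {}mE] := choice mE.
have ms n : states (m n).
  split=> [f f0|]; rewrite mE.
    rewrite mulr_ge0 ?invr_ge0//; apply: (nus n).1 => x; rewrite cts_sumE.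
    by apply: sumr_ge0 => i _; exact: iter_endo_nonneg.
  have -> : birkhoff delta 1 n.+1 = n.+1%:R *: 1.
    rewrite /birkhoff (eq_bigr (fun=> 1)) ?sumr_const ?card_ord ?scaler_nat//.
    by move=> i _; rewrite rmorph1.
  by rewrite state_cst// mulVf.
have [mu mus mcv] := state_ultralimit cptX GU ms.
have {}mcv f : n.+1%:R^-1 * nu n (birkhoff delta f n.+1) @[n --> G] --> mu f.
  by under eq_cvg do rewrite -mE; exact: mcv.
exists mu => //; split => // f.
have [b b0 fb] := cts_bounded cptX f.
apply/eqP; rewrite -subr_eq0; apply/eqP.
have h0 : n.+1%:R^-1 * (nu n (iter n.+1 delta f - f)) @[n --> G] --> (0 : R).
  have : (2 * b) * harmonic n @[n --> \oo] --> 2 * b * 0.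
    by apply: cvgMr; exact: cvg_harmonic.
  rewrite mulr0 => /(cvg_trans (cvg_app _ Goo)) h.
  have /cvgN := h; rewrite oppr0 => hN.
  apply: squeeze_cvgr hN h; apply: nearW => n.
  rewrite -ler_norml normrM ger0_norm ?invr_ge0// /harmonic /= mulrC.
  rewrite ler_wpM2r ?invr_ge0//; apply: state_norm_le => // x.
  rewrite !ctsE (le_trans (ler_normB _ _))// mulr_natl mulr2n lerD//.
  exact: (iter_endo_norm_le delta n.+1 fb x).
have h1 : n.+1%:R^-1 * (nu n (iter n.+1 delta f - f)) @[n --> G] -->
    mu (delta f) - mu f.
  have fE n : iter n.+1 delta f - f =
      birkhoff delta (delta f) n.+1 - birkhoff delta f n.+1.
    by apply/eqP; rewrite subr_eq addrAC eq_sym subr_eq birkhoff_endo addrC.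
  under eq_cvg => n do rewrite fE linearB mulrBr.
  exact: cvgB (mcv (delta f)) (mcv f).
exact: cvg_unique h1 h0.
Qed.

(** One [mu] serves all [L], [phi], [n] and [theta]. The number [L] stands for a finite [l(psi)],
    and its hypothesis says that [max A^N psi_N >= exp (N L)]. *)
Lemma exists_equilibrium_state psi : nonneg psi ->
  exists2 mu, invariant_states delta mu & forall L : R,
    (forall N, (0 < N)%N ->
      exists x, expR (N%:R * L) <= iter N A (weight delta psi N) x) ->
    forall phi, (forall x, psi x <= cexp phi x) ->
    forall n theta, (0 < n)%N -> (forall x, iter n A (cexp theta) x <= 1) ->
    mu theta <= n%:R * (mu phi - L).
Proof.
move=> psi0.
have [G [GU Goo]] := exists_ultra_infty.
have GP : ProperFilter G by exact: ultra_proper.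
pose a N := iter N A (weight delta psi N).
have [xs xsP] := choice (fun N => cts_max cptX (a N)).
(* If the maximum of [a N] is not positive, the quotient makes no sense and a point evaluation fills
   the gap. The hypothesis on [L] excludes this case for [N > 0]. *)
have nuE N : exists nu : {scalar C(X, R)}, states nu /\
    (0 < a N (xs N) -> forall f,
      nu f = iter N A (weight delta psi N * f) (xs N) / a N (xs N)).
  have [a0|_] := boolP (0 < a N (xs N)); last first.
    by have [mu [mus _]] := exists_eval_state R (xs N); exists mu.
  have [nu nuE] : exists nu : {scalar C(X, R)}, forall f,
      nu f = iter N A (weight delta psi N * f) (xs N) / a N (xs N).
    apply: scalar_of => c f g.
    have -> : weight delta psi N * (c *: f + g) =
        c *: (weight delta psi N * f) + weight delta psi N * g.
      by apply: ctsP => x; rewrite !ctsE; ring.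
    by rewrite linearP !ctsE mulrDl mulrA.
  exists nu; split => //; split=> [f f0|]; rewrite nuE.
    rewrite divr_ge0//; last exact: ltW.
    by apply: (iter_nonneg hA.1); apply: nonneg_mul => //; exact: nonneg_weight.
  by rewrite mulr1 -/(a N) mulfV ?gt_eqF.
have [nu0 {}nuE] := choice nuE; pose nu n := nu0 n.+1.
have [|mu mui mucv] := birkhoff_average_limit (nu := nu) GU Goo.
  by move=> n; exact: (nuE n.+1).1.
exists mu => // L LP phi psiphi n theta n0 t1.
have ag N : (0 < N)%N -> expR (N%:R * L) <= a N (xs N).
  by move=> /LP[x hx]; exact: le_trans (xsP N x).
have [b b0 tb] := cts_bounded cptX theta.
have [C C1 CP] := iter_transfer_bounded cptX A n.*2.
pose K := n%:R * ln (C ^+ 2) + n.*2%:R * b.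
(* This is the block estimate divided by [N + 1]; its constant [K] depends on neither [N] nor the
   state, so the error vanishes in the limit. *)
have main N : (n <= N.+1)%N ->
    N.+1%:R^-1 * nu N (birkhoff delta theta N.+1) <=
    n%:R * (N.+1%:R^-1 * nu N (birkhoff delta phi N.+1)) - n%:R * L + K * harmonic N.
  move=> nN; have a0 : 0 < a N.+1 (xs N.+1) by exact: lt_le_trans (expR_gt0 _) (ag N.+1 isT).
  have := gibbs_block_estimate hA psi0 psiphi t1 tb C1 CP _ a0 (nuE N.+1).1
    ((nuE N.+1).2 a0).
  rewrite n0 nN => /(_ isT).
  have La : N.+1%:R * L <= ln (a N.+1 (xs N.+1)).
    have pa : a N.+1 (xs N.+1) \in Num.pos by rewrite posrE.
    rewrite -ler_expR (lnK pa); exact: ag.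
  rewrite -/(nu N) -/K => h.
  have h2 : nu N (birkhoff delta theta N.+1) <=
      n%:R * nu N (birkhoff delta phi N.+1) - n%:R * (N.+1%:R * L) + K.
    have : n%:R * (N.+1%:R * L) <= n%:R * ln (a N.+1 (xs N.+1)) by rewrite ler_wpM2l.
    lra.
  apply: le_trans (ler_wpM2l _ h2) _; first by rewrite invr_ge0.
  rewrite /harmonic /= le_eqVlt; apply/orP; left; apply/eqP.
  have := pnatr_eq0 R N.+1; move: (N.+1%:R : R) => d d0.
  by field; rewrite d0.
have hK : K * harmonic N @[N --> G] --> K * 0.
  apply: cvgMr; apply: cvg_trans cvg_harmonic; exact: cvg_app.
have hr : n%:R * (N.+1%:R^-1 * nu N (birkhoff delta phi N.+1)) - n%:R * L +
    K * harmonic N @[N --> G] --> n%:R * mu phi - n%:R * L + K * 0.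
  by apply: cvgD hK; apply: cvgD; [apply: cvgMr; exact: mucv|exact: cvg_cst].
rewrite mulrBr -[leRHS]addr0 -[X in _ + X](mulr0 K).
apply: (ler_cvg_to (mucv theta) hr); apply: Goo.
by exists n => // N /= nN; apply: main; exact: leqW.
Qed.

End equilibrium.

(** * Duality for the t-entropy *)

(** Equality holds at [w = y^-1], so [ln y] is an infimum of functions affine in [y]. Such bounds
    can be summed, and they survive limits in which [y] tends to zero. *)
Lemma ln_le_tangent (R : realType) (y w : R) : 0 < y -> 0 < w ->
  ln y <= y * w - 1 - ln w.
Proof.
move=> y0 w0; rewrite lerBrDr -lnM ?posrE//.
have := @le_ln1Dx R (y * w - 1); rewrite addrCA subrr addr0; apply.
by rewrite ltrBrDl subrr mulr_gt0.
Qed.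

Section duality.
Variables (X : ptopologicalType) (R : realType).
Hypothesis cptX : compact [set: X].
Variable B : {linear C(X, R) -> C(X, R)}.
Hypothesis B0 : forall f, nonneg f -> nonneg (B f).
Variables (I : finType) (g : I -> C(X, R)).
Hypotheses (g0 : forall i, nonneg (g i)) (g1 : \sum_i g i = 1).
Implicit Types (f theta : C(X, R)) (x : X).

Let state_B_ge0 (m : {scalar C(X, R)}) i : states m -> 0 <= m (B (g i)).
Proof. by move=> ms; apply: ms.1; exact: B0. Qed.

(* The perturbation [eta] keeps the logarithms defined where [m (B (g i))] vanishes. *)
Section perturbed.
Variables (p : I -> R) (eta : R).
Hypotheses (p0 : forall i, 0 < p i) (eta0 : 0 < eta).

Let F (m : {scalar C(X, R)}) := \sum_i p i * ln (m (B (g i)) + eta).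

(** A maximising sequence has an ultralimit, at which [F] is continuous since each argument of [ln]
    stays at least [eta]. *)
Lemma exists_max_state : exists2 m, states m & forall m', states m' -> F m' <= F m.
Proof.
pose S := [set F m | m in @states X R].
have S0 : S !=set0.
  have [m [ms _]] := exists_eval_state R (point : X).
  by exists (F m); exists m.
have [b bP] := choice (fun i => let: ex_intro2 b _ h := cts_bounded cptX (B (g i))
  in ex_intro (fun b => forall x, `|B (g i) x| <= b) b h).
have Sub : has_ubound S.
  exists (\sum_i p i * ln (b i + eta)) => _ [m ms <-]; apply: ler_sum => i _.
  rewrite ler_wpM2l ?(ltW (p0 i))// ler_ln ?posrE.
  - by rewrite lerD2r (le_trans (ler_norm _))// state_norm_le.
  - by rewrite ltr_wpDl ?state_B_ge0.
  - by rewrite ltr_wpDl// (le_trans _ (bP i point)).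
have /choice[m mP] : forall n, exists m, states m /\ sup S - harmonic n < F m.
  move=> n; have [_ [m ms <-] h] := sup_adherent (harmonic_gt0 n) (conj S0 Sub).
  by exists m.
have [G [GU Goo]] := exists_ultra_infty.
have GP : ProperFilter G by exact: ultra_proper.
have [mu mus mucv] := state_ultralimit cptX GU (fun n => (mP n).1).
exists mu => // m' ms'.
apply: (@le_trans _ _ (sup S)); first by apply: ub_le_sup => //; exists m'.
have Fcv : F (m n) @[n --> G] --> F mu.
  apply: cvg_big => [|i _]; first exact: add_continuous.
  apply: cvgMr; apply: (@cvg_comp _ _ _ (fun n => m n (B (g i)) + eta) (@ln R)).
    by apply: cvgD (mucv _) (cvg_cst _).
  by apply: continuous_ln; rewrite ltr_wpDl ?state_B_ge0.
have Scv : sup S - harmonic n @[n --> G] --> sup S - 0.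
  apply: cvgB; first exact: cvg_cst.
  by apply: cvg_trans cvg_harmonic; exact: cvg_app.
rewrite -[leLHS]subr0; apply: (ler_cvg_to Scv Fcv); apply: nearW => n.
exact/ltW/(mP n).2.
Qed.

(** Moving from [m] towards [m'] cannot increase [F], so the one-sided derivative
    [\sum_i p i * ((z i - y i) / y i)] is at most zero. Replacing [z i] by the smaller
    [m' (B (g i))] gives the claim. *)
Lemma max_state_first_order (m : {scalar C(X, R)}) : states m ->
  (forall m', states m' -> F m' <= F m) ->
  forall m', states m' ->
  \sum_i p i / (m (B (g i)) + eta) * m' (B (g i)) <= \sum_i p i.
Proof.
move=> ms mmax m' ms'.
pose y i := m (B (g i)) + eta; pose z i := m' (B (g i)) + eta.
have y0 i : 0 < y i by rewrite ltr_wpDl ?state_B_ge0.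
have z0 i : 0 < z i by rewrite ltr_wpDl ?state_B_ge0.
pose K := \sum_i p i * (`|z i - y i| * z i / y i ^+ 2).
have K0 : 0 <= K.
  apply: sumr_ge0 => i _; rewrite mulr_ge0 ?(ltW (p0 i))//.
  by rewrite divr_ge0 ?mulr_ge0 ?exprn_ge0// ltW.
(* No derivative is taken: [F] is compared at [m] and at the state [(m + r m') / (1 + r)], with an
   explicit remainder [r * K], and [r] tends to zero afterwards. *)
have segment r : 0 < r -> \sum_i p i * ((z i - y i) / y i) <= r * K.
  move=> r0; have r1 : 0 < 1 + r by rewrite addr_gt0.
  have [mr mrE] : exists mr : {scalar C(X, R)}, forall f,
      mr f = (1 + r)^-1 * (m f + r * m' f).
    apply: scalar_of => a f h; rewrite !linearP /=.
    by rewrite /GRing.scale /=; ring.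
  have mrs : states mr.
    split=> [f f0|]; rewrite mrE.
      by rewrite mulr_ge0 ?invr_ge0 ?(ltW r1)// addr_ge0 ?ms.1// mulr_ge0 ?ms'.1 ?(ltW r0).
    by rewrite ms.2 ms'.2 mulr1 mulVf// gt_eqF.
  have -> : r * K = \sum_i r * (p i * (`|z i - y i| * z i / y i ^+ 2)).
    by rewrite mulr_sumr.
  rewrite -subr_le0 -sumrB -(pmulr_rle0 _ r0) mulr_sumr.
  have : F mr - F m <= 0 by rewrite subr_le0 mmax.
  rewrite /F -sumrB; apply: le_trans.
  apply: ler_sum => i _; rewrite -/(y i) [leRHS](esym (mulrBr _ _ _)).
  rewrite [r * (p i * _)]mulrCA -[X in r * X](mulrBr (p i)) mulrCA.
  rewrite ler_wpM2l ?(ltW (p0 i))// mrE.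
  have -> : (1 + r)^-1 * (m (B (g i)) + r * m' (B (g i))) + eta =
      (y i + r * z i) / (1 + r).
    by rewrite /y /z; field; rewrite gt_eqF.
  have yrz : 0 < y i + r * z i by rewrite addr_gt0// mulr_gt0.
  have := @ln_le_tangent R (y i) ((y i + r * z i) / (1 + r))^-1 (y0 i).
  rewrite invr_gt0 divr_gt0// lnV ?posrE ?divr_gt0// => /(_ isT) tangent.
  apply: (@le_trans _ _ (1 - y i * ((y i + r * z i) / (1 + r))^-1)); last by lra.
  have -> : 1 - y i * ((y i + r * z i) / (1 + r))^-1 =
      r * ((z i - y i) / (y i + r * z i)).
    by field; rewrite !gt_eqF.
  rewrite ler_wpM2l ?(ltW r0)// lerBlDr -lerBlDl.
  have -> : (z i - y i) / y i - (z i - y i) / (y i + r * z i) =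
      r * ((z i - y i) * z i / (y i * (y i + r * z i))).
    by field; rewrite !gt_eqF.
  rewrite ler_wpM2l ?(ltW r0)// -!mulrA.
  apply: (@le_trans _ _ (`|z i - y i| * (z i / (y i * (y i + r * z i))))).
    by rewrite ler_wpM2r ?ler_norm// divr_ge0 ?mulr_ge0 ?ltW.
  rewrite ler_wpM2l// ler_wpM2l ?(ltW (z0 i))// lef_pV2 ?posrE ?exprn_gt0 ?mulr_gt0//.
  by rewrite expr2 ler_wpM2l ?(ltW (y0 i))// lerDl mulr_ge0 ?ltW.
have main : \sum_i p i * ((z i - y i) / y i) <= 0.
  apply/ler_addgt0Pl => e e0; rewrite addr0.
  apply: le_trans (segment (e / (K + 1)) _) _; first by rewrite divr_gt0// ltr_wpDl.
  by rewrite mulrAC ler_pdivrMr ?ltr_wpDl// mulrDr mulr1 lerDl ltW.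
rewrite -subr_le0 -sumrB; apply: le_trans main; apply: ler_sum => i _.
rewrite -/(y i) -mulrA -[X in _ - X]mulr1 -mulrBr ler_wpM2l ?(ltW (p0 i))//.
rewrite mulrBl mulfV ?gt_eqF// lerD2r mulrC ler_wpM2r ?invr_ge0 ?(ltW (y0 i))//.
by rewrite lerDl ltW.
Qed.

End perturbed.

(** The numbers [g i x] are weights of total mass one, so this is Jensen's inequality for [ln],
    proved with the tangent at the mean [H]. *)
Lemma ln_concave_partition (t : I -> R) x : (forall i, 0 < t i) ->
  0 < \sum_i t i * g i x /\
  \sum_i ln (t i) * g i x <= ln (\sum_i t i * g i x).
Proof.
move=> t0; have gx1 : \sum_i g i x = 1 by rewrite -cts_sumE g1 ctsE.
have H0 : 0 < \sum_i t i * g i x.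
  have tg0 i : 0 <= t i * g i x by apply: mulr_ge0; [exact: ltW|exact: g0].
  rewrite lt_neqAle sumr_ge0// andbT; apply/eqP => /esym/eqP.
  rewrite psumr_eq0// => /allP gz.
  move: gx1; rewrite big1 => [/esym/eqP|i _]; first by rewrite oner_eq0.
  have := gz i (mem_index_enum i).
  by rewrite mulf_eq0 (gt_eqF (t0 i)) => /eqP.
split => //; set H := \sum_i t i * g i x in H0 *.
apply: (@le_trans _ _ (\sum_i (t i / H - 1 + ln H) * g i x)).
  apply: ler_sum => i _; rewrite ler_wpM2r ?g0//.
  have := @ln_le_tangent R (t i) H^-1 (t0 i).
  by rewrite invr_gt0 H0 lnV ?posrE// opprK; apply.
rewrite (eq_bigr (fun i => H^-1 * (t i * g i x) + (ln H - 1) * g i x)); last first.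
  by move=> i _; ring.
by rewrite big_split /= -!mulr_sumr gx1 -/H mulVf ?gt_eqF// mulr1 addrC subrK.
Qed.

Section dual_bound.
Variables (mu : {scalar C(X, R)}) (L : R).
Hypothesis mus : states mu.
Hypothesis muL : forall theta, (forall x, B (cexp theta) x <= 1) -> mu theta <= - L.

Let mug0 i : 0 <= mu (g i).
Proof. by apply: mus.1; exact: g0. Qed.

Let mug1 : \sum_i mu (g i) = 1.
Proof. by rewrite -linear_sum g1 mus.2. Qed.

(** The test function is [cexp theta = \sum_i t i *: g i]. The first order condition, read at point
    evaluations, says that [B (cexp theta) <= 1]; concavity of [ln] bounds [mu theta] below by
    [\sum_i ln (t i) * mu (g i)]. *)
Lemma perturbed_dual_bound eta : 0 < eta -> exists2 m, states m &
  L + \sum_i mu (g i) * ln (mu (g i)) - #|I|%:R * eta <=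
  \sum_i mu (g i) * ln (m (B (g i)) + eta).
Proof.
(* Adding [eta] makes all weights positive, hence all [t i] too. The total mass becomes
   [M = 1 + #|I| * eta], and [ln M] is the error term of the statement. *)
move=> eta0; pose p i := mu (g i) + eta.
have p0 i : 0 < p i by rewrite ltr_wpDl.
have [m ms mmax] := exists_max_state p0 eta0; exists m => //.
have fo := max_state_first_order p0 eta0 ms mmax.
have y0 i : 0 < m (B (g i)) + eta by rewrite ltr_wpDl ?state_B_ge0.
have Mp : \sum_i p i = 1 + #|I|%:R * eta.
  by rewrite big_split /= mug1 sumr_const mulr_natl.
have M0 : 0 < 1 + #|I|%:R * eta by rewrite ltr_wpDr// mulr_ge0// ltW.
set M := 1 + _ in Mp M0.
pose t i := p i / (m (B (g i)) + eta) / M.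
have t0 i : 0 < t i by rewrite !divr_gt0.
have hE x : (\sum_i t i *: g i) x = \sum_i t i * g i x.
  by rewrite cts_sumE; apply: eq_bigr => i _; rewrite ctsE.
have [|theta thetaE] := @exists_cln X R (\sum_i t i *: g i).
  by move=> x; rewrite hE; exact: (ln_concave_partition x t0).1.
have thetaL : \sum_i ln (t i) * mu (g i) <= - L.
  have <- : mu (\sum_i ln (t i) *: g i) = \sum_i ln (t i) * mu (g i).
    by rewrite linear_sum; apply: eq_bigr => i _; rewrite linearZ.
  apply: le_trans (muL (theta := theta) _) => [|x].
    apply: state_le => // x.
    have -> : theta x = ln (\sum_i t i * g i x).
      by rewrite -hE -thetaE cts_compE expRK.
    apply: le_trans (ln_concave_partition x t0).2; rewrite cts_sumE.
    by apply: ler_sum => i _; rewrite ctsE.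
  have [mx [mxs mxE]] := exists_eval_state R x.
  have -> : B (cexp theta) x =
      M^-1 * \sum_i p i / (m (B (g i)) + eta) * mx (B (g i)).
    rewrite thetaE linear_sum cts_sumE mulr_sumr; apply: eq_bigr => i _.
    by rewrite linearZ ctsE mxE /t mulrC [RHS]mulrC; ring.
  by rewrite mulrC ler_pdivrMr// mul1r -Mp fo.
have lnt i : ln (t i) = ln (p i) - ln (m (B (g i)) + eta) - ln M.
  by rewrite !ln_div ?posrE ?divr_gt0.
have lnM : ln M <= #|I|%:R * eta.
  by apply: le_ln1Dx; rewrite (lt_le_trans (ltrN10 R))// mulr_ge0// ltW.
have lnp : \sum_i mu (g i) * ln (mu (g i)) <= \sum_i mu (g i) * ln (p i).
  apply: ler_sum => i _; have := mug0 i; rewrite le_eqVlt => /predU1P[<-|mg].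
    by rewrite !mul0r.
  by rewrite ler_wpM2l// ler_ln ?posrE// lerDl ltW.
have : \sum_i mu (g i) * ln (p i) - \sum_i mu (g i) * ln (m (B (g i)) + eta) -
    ln M <= - L.
  apply: le_trans thetaL; rewrite -[ln M]mul1r -mug1 mulr_suml -!sumrB.
  by apply: ler_sum => i _; rewrite lnt; lra.
lra.
Qed.

(** The perturbation tends to zero along an ultrafilter. The logarithms may degenerate in the limit,
    so their affine upper bounds are passed to the limit instead. *)
Lemma dual_bound : exists2 m, states m & (L%:E <=
  \sum_i (if mu (g i) == 0%R then 0
          else (mu (g i))%:E * lne (m (B (g i)) / mu (g i))%:E))%E.
Proof.
have /choice[mn mnP] : forall n, exists m, states m /\
    L + \sum_i mu (g i) * ln (mu (g i)) - #|I|%:R * harmonic n <=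
    \sum_i mu (g i) * ln (m (B (g i)) + harmonic n).
  move=> n; have [m ms h] := perturbed_dual_bound (harmonic_gt0 n).
  by exists m.
have [G [GU Goo]] := exists_ultra_infty.
have GP : ProperFilter G by exact: ultra_proper.
have [m ms mcv] := state_ultralimit cptX GU (fun n => (mnP n).1).
exists m => //.
have tangent (w : I -> R) : (forall i, 0 < w i) ->
    L + \sum_i mu (g i) * ln (mu (g i)) <=
    \sum_i mu (g i) * (m (B (g i)) * w i - 1 - ln (w i)).
  move=> w0; pose f := \sum_i (mu (g i) * w i) *: B (g i).
  pose c := \sum_i mu (g i) * (- 1 - ln (w i)).
  have fE (m' : {scalar C(X, R)}) :
      m' f = \sum_i mu (g i) * (m' (B (g i)) * w i).
    rewrite linear_sum; apply: eq_bigr => i _; rewrite linearZ /=.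
    by rewrite /GRing.scale /=; ring.
  have -> : \sum_i mu (g i) * (m (B (g i)) * w i - 1 - ln (w i)) = m f + c.
    by rewrite fE -big_split /=; apply: eq_bigr => i _; ring.
  pose d := \sum_i mu (g i) * w i.
  have hh : harmonic n @[n --> G] --> (0 : R).
    by apply: cvg_trans cvg_harmonic; exact: cvg_app.
  have l1 : L + \sum_i mu (g i) * ln (mu (g i)) - #|I|%:R * harmonic n @[n --> G] -->
      L + \sum_i mu (g i) * ln (mu (g i)) - #|I|%:R * 0.
    by apply: cvgB; [exact: cvg_cst|exact: cvgMr].
  have l2 : mn n f + c + d * harmonic n @[n --> G] --> m f + c + d * 0.
    by apply: cvgD; [apply: cvgD; [exact: mcv|exact: cvg_cst]|exact: cvgMr].
  have := ler_cvg_to l1 l2; rewrite !mulr0 subr0 addr0; apply.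
  apply: nearW => n; apply: le_trans (mnP n).2 _.
  rewrite fE /c /d mulr_suml -!big_split /=; apply: ler_sum => i _.
  apply: (@le_trans _ _ (mu (g i) *
      ((mn n (B (g i)) + harmonic n) * w i - 1 - ln (w i)))).
    rewrite ler_wpM2l// ln_le_tangent// ltr_wpDl ?state_B_ge0//.
    exact: (mnP n).1.
  by rewrite /= le_eqVlt; apply/orP; left; apply/eqP; ring.
have mB0 i : states m -> 0 <= m (B (g i)) by exact: state_B_ge0.
have mBgt0 i : mu (g i) != 0 -> 0 < m (B (g i)).
  move=> mui; rewrite lt_neqAle mB0// andbT; apply/negP => /eqP mBi.
  have mui0 : 0 < mu (g i) by rewrite lt_neqAle eq_sym mui mug0.
  pose c := \sum_(j | j != i) mu (g j) * (m (B (g j)) - 1).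
  pose L' := L + \sum_i mu (g i) * ln (mu (g i)).
  (* With [w i = expR T] and the other weights [1], the right side of [tangent] is at most
     [L' - 1 - mu (g i)], which is less than [L']. *)
  pose T := (c + 1 - L') / mu (g i).
  have : L' <= mu (g i) * (- 1 - T) + c.
    have w0 j : 0 < (if j == i then expR T else 1).
      by case: ifP => // _; exact: expR_gt0.
    have := tangent _ w0; rewrite -/L' (bigD1 i)//= eqxx -mBi mul0r expRK sub0r.
    move=> /le_trans; apply; rewrite lerD2l; apply: ler_sum => j /negbTE ->.
    by rewrite ln1 subr0 mulr1.
  have -> : mu (g i) * (- 1 - T) = - mu (g i) - (c + 1 - L').
    by rewrite /T; field.
  lra.
(* The inverse makes the tangent bound exact. The default [1] is met only where [mu (g i) = 0], by
   [mBgt0]. *)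
pose w i := if m (B (g i)) == 0 then 1 else (m (B (g i)))^-1.
have w0 i : 0 < w i.
  rewrite /w; case: eqVneq => // mi; rewrite invr_gt0 lt_neqAle eq_sym mi.
  exact: mB0.
have Lw := tangent w w0.
have -> : (\sum_i (if mu (g i) == 0%R then 0
    else (mu (g i))%:E * lne (m (B (g i)) / mu (g i))%:E))%E =
    (\sum_i mu (g i) * (ln (m (B (g i))) - ln (mu (g i))))%:E.
  rewrite -sumEFin; apply: eq_bigr => i _; case: eqVneq => [->|mui].
    by rewrite mul0r.
  have mui0 : 0 < mu (g i) by rewrite lt_neqAle eq_sym mui mug0.
  by rewrite lne_EFin ?divr_gt0 ?mBgt0// ln_div ?posrE ?mBgt0.
rewrite lee_fin -(lerD2r (\sum_i mu (g i) * ln (mu (g i)))) (le_trans Lw)//.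
rewrite -big_split /=; apply: ler_sum => i _; rewrite /w.
have [->|mui] := eqVneq (mu (g i)) 0; first by rewrite !mul0r addr0.
have mB := mBgt0 i mui; rewrite gt_eqF// lnV ?posrE//.
by rewrite le_eqVlt; apply/orP; left; apply/eqP; field; rewrite gt_eqF.
Qed.
End dual_bound.
End duality.

(** * Partitions of unity *)

(* A partition of unity is a set of functions, so two equal members of a family
   have to be merged into one, their sum. *)
Section merging.
Variables (V : zmodType) (Q : V -> Prop).
Hypothesis Qdouble : forall v, Q v -> Q (v + v).

(** If [v] already occurs, it is deleted and [v + v] is inserted into the shorter list, which may
    collide again; hence the induction on the length. *)
Lemma insert_merging (s : seq V) v : uniq s -> (forall u, u \in s -> Q u) -> Q v ->
  exists s', [/\ uniq s', forall u, u \in s' -> Q u &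
    \sum_(u <- s') u = v + \sum_(u <- s) u].
Proof.
have [n] := ubnP (size s); elim: n s v => // n IH s v sn us Qs Qv.
have [vs|vs] := boolP (v \in s); last first.
  exists (v :: s); rewrite /= vs big_cons; split => // u.
  by rewrite inE => /predU1P[->|/Qs].
have [||||s' [us' Qs' s'E]] := IH (rem v s) (v + v).
- by rewrite size_rem//; case: s sn {Qs us} vs.
- exact: rem_uniq.
- by move=> u /mem_rem/Qs.
- exact: Qdouble.
by exists s'; split => //; rewrite s'E (perm_big _ (perm_to_rem vs)) big_cons/= addrA.
Qed.

Lemma merge_duplicates (s : seq V) : (forall u, u \in s -> Q u) ->
  exists s', [/\ uniq s', forall u, u \in s' -> Q u &
    \sum_(u <- s') u = \sum_(u <- s) u].
Proof.
elim: s => [|v s IH] Qs; first by exists [::].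
have [u us|s' [us' Qs' s'E]] := IH; first by apply: Qs; rewrite inE us orbT.
have [|t [ut Qt tE]] := insert_merging us' Qs' (v := v).
  by apply: Qs; rewrite inE eqxx.
by exists t; split => //; rewrite tE big_cons s'E.
Qed.

End merging.

Section fine_partitions.
Variables (X : ptopologicalType) (R : realType).
Hypothesis cptX : compact [set: X].
Implicit Types (f g S : C(X, R)) (x : X).

(** Truncation to [[0, 1]], written with absolute values so that continuity is automatic. *)
Definition clamp f : C(X, R) := 2^-1 *: (cabs f - cabs (f - 1) + 1).

Lemma clampE f x : clamp f x = if f x <= 0 then 0 else if f x <= 1 then f x else 1.
Proof.
rewrite /clamp !ctsE !cabsE !ctsE.
case: ifPn => [f0|]; rewrite -?ltNge.
  by rewrite (ler0_norm f0) (@ler0_norm _ (f x - 1)); [field|lra].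
move=> f0; case: ifPn => [f1|]; rewrite -?ltNge.
  by rewrite (gtr0_norm f0) (@ler0_norm _ (f x - 1)); [field|lra].
by move=> f1; rewrite (gtr0_norm f0) (@gtr0_norm _ (f x - 1)); [field|lra].
Qed.

Lemma clamp_step (t : R) :
  let cl t := if t <= 0 then 0 else if t <= 1 then t else 1 in
  0 <= cl t - cl (t - 1) /\ (0 < cl t - cl (t - 1) -> 0 <= t <= 2).
Proof.
move=> cl; rewrite /cl.
have [t0|t0] := leP t 0; have [t1|t1] := leP (t - 1) 0;
have [t2|t2] := leP t 1; have [t3|t3] := leP (t - 1) 1;
  split => [|h]; try lra; apply/andP; split; lra.
Qed.

(** Differences of consecutive clamps of a rescaled [S] are tent functions of [S]. They telescope to
    [1], and each lives where [S] is within [e] of a constant. *)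
Lemma fine_partition S (e : R) : 0 < e -> exists2 D : {fset C(X, R)},
  partition_of_unity D &
  forall g, g \in D -> exists a, forall x, 0 < g x -> `|S x - a| <= e.
Proof.
move=> e0; have [b b0 Sb] := cts_bounded cptX S.
(* The shift gives [1 <= u <= K], so that the first clamp is [1] everywhere and the last one is
   [0]. *)
have [u uE] : exists u : C(X, R), forall x, u x = (S x + b) / e + 1.
  by exists (e^-1 *: (S + b *: 1) + 1) => x; rewrite !ctsE mulr1 mulrC.
have [c cE] : exists c : nat -> C(X, R), forall k x,
    c k x = if u x - k%:R <= 0 then 0 else
      if u x - k%:R <= 1 then u x - k%:R else 1.
  exists (fun k => clamp (u - k%:R *: 1)) => k x.
  have uiE : (u - k%:R *: 1) x = u x - k%:R by rewrite !ctsE !mulr1.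
  by rewrite clampE uiE.
pose K := (Num.truncn (2 * b / e + 1)).+1.
have uK x : 1 <= u x <= K%:R.
  have := Sb x; rewrite ler_norml => /andP[S1 S2]; rewrite uE.

  apply/andP; split; first by rewrite lerDr divr_ge0 ?(ltW e0)//; lra.
  apply: (@le_trans _ _ (2 * b / e + 1)).
    by rewrite lerD2r ler_wpM2r ?invr_ge0 ?(ltW e0)//; lra.
  exact/ltW/truncnS_gt.
pose Q g := nonneg g /\ exists a, forall x, 0 < g x -> `|S x - a| <= e.
have Qdouble g : Q g -> Q (g + g).
  move=> [g0 [a ga]]; split=> [x|]; first by rewrite ctsE addr_ge0.
  by exists a => x; rewrite ctsE => h; apply: ga; have := g0 x; lra.
have [s [us Qs sE]] : exists s, [/\ uniq s, forall g, g \in s -> Q g &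
    \sum_(g <- s) g = \sum_(g <- [seq c k - c k.+1 | k <- iota 0 K]) g].
  apply: merge_duplicates => // _ /mapP[k _ ->].
  have step x : 0 <= (c k - c k.+1) x /\
      (0 < (c k - c k.+1) x -> 0 <= u x - k%:R <= 2).
    have -> : (c k - c k.+1) x = c k x - c k.+1 x by [].
    by rewrite !cE -natr1 opprD addrA; exact: clamp_step.
  split=> [x|]; first exact: (step x).1.
  (* The tent number [k] is positive only where [k <= u <= k + 2], and this value of [S] corresponds
     to the centre [u = k + 1]. *)
  exists (e * k%:R - b) => x /(step x).2; rewrite uE => /andP[h1 h2].
  have {}h1 : e * k%:R <= S x + b + e.
    have : k%:R - 1 <= (S x + b) / e by lra.
    by rewrite ler_pdivlMr// => ?; lra.
  have {}h2 : S x + b <= e * k%:R + e.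
    have : (S x + b) / e <= k%:R + 1 by lra.
    by rewrite ler_pdivrMr// => ?; lra.
  by rewrite ler_norml; apply/andP; split; lra.
have inD g : (g \in [fset g in s]%fset) = (g \in s) by rewrite inE.
exists [fset g in s]%fset; last by move=> g; rewrite inD => /Qs[].
split=> [g|]; first by rewrite inD => /Qs[].
rewrite (perm_big s); last first.
  by apply: uniq_perm; [exact: fset_uniq|exact: us|exact: inD].
have -> : \sum_(g <- s) g = \sum_(0 <= k < K) (c k - c k.+1).
  by rewrite sE big_map /index_iota subn0.
rewrite (eq_bigr (fun k => - (c k.+1 - c k))) => [|k _]; last by rewrite opprB.
rewrite sumrN telescope_sumr// opprB.
apply: ctsP => x; have /andP[u1 u2] := uK x.
have -> : (c 0%N - c K) x = c 0%N x - c K x by [].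
rewrite !cE [(1 : C(X, R)) x]ctsE subr0.
rewrite [u x - _ <= 0]subr_le0 u2 (lt_geF (lt_le_trans ltr01 u1)).
case: ifPn => [u3|_]; last by rewrite subr0.
by apply/eqP; rewrite subr0 eq_le u3 u1.
Qed.

End fine_partitions.

(** The tangent inequality at slope [expR w], multiplied by [p], including the convention for
    [p = 0] and the value [-oo] at [y = 0]. *)
Lemma lne_le_tangent (R : realType) (y w p : R) : 0 <= y -> 0 <= p ->
  ((if p == 0%R then 0 else p%:E * lne (y / p)%:E) <=
   (y * expR w - p - p * w)%:E)%E.
Proof.
move=> y0 p0; have [->|pn0] := eqVneq p 0.
  by rewrite lee_fin mul0r !subr0 mulr_ge0// expR_ge0.
have {pn0}p0 : 0 < p by rewrite lt_neqAle eq_sym pn0.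
have [->|yn0] := eqVneq y 0.
  by rewrite mul0r le0_lneNy// mulrNy gtr0_sg// mul1e leNye.
have {yn0}y0 : 0 < y by rewrite lt_neqAle eq_sym yn0.
rewrite lne_EFin ?divr_gt0// -EFinM lee_fin.
have := @ln_le_tangent R (y / p) (expR w).
rewrite divr_gt0// expR_gt0 expRK => /(_ isT isT) h.
have -> : y * expR w - p - p * w = p * (y / p * expR w - 1 - w).
  by field; rewrite gt_eqF.
by rewrite ler_wpM2l// ltW.
Qed.

(** * Upper and lower bounds for the t-entropy *)

Section entropy_bounds.
Variables (X : ptopologicalType) (R : realType).
Hypothesis cptX : compact [set: X].
Variables (delta : {lrmorphism C(X, R) -> C(X, R)}).
Variables (A : {linear C(X, R) -> C(X, R)}).
Hypothesis hA : transfer_operator delta A.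
Implicit Types (f g phi S : C(X, R)) (x : X).

Lemma partition_sum (D : {fset C(X, R)}) : partition_of_unity D ->
  \sum_(i : D) val i = 1 :> C(X, R).
Proof. by move=> [_ <-]; rewrite big_seq_fsetE. Qed.

Lemma tau_n_le (mu : {scalar C(X, R)}) n S (c : R) : states mu ->
  (forall x, iter n A (cexp S) x <= expR c) -> (tau_n A n mu <= (c - mu S)%:E)%E.
Proof.
move=> mus AS; apply/lee_addgt0Pr => e e0; rewrite -EFinD.
have e20 : 0 < e / 2 by rewrite divr_gt0.
have [D Dpou Da] := fine_partition cptX S e20; set e2 := e / 2 in Da e20.
have {}Da : forall i : D, exists a, forall x, 0 < val i x -> `|S x - a| <= e2.
  by move=> i; exact: Da (valP i).
have [a aP] := choice Da.
have g0 (i : D) : nonneg (val i) by exact: Dpou.1 (valP i).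
have g1 := partition_sum Dpou.
apply: (@le_trans _ _ (tau_nD A n mu D)); first by apply: ereal_inf_lbound; exists D.
apply: ge_ereal_sup => _ [m ms <-].
rewrite big_seq_fsetE /=.
(* On the support of the [i]-th member, [expR (a i - e2) <= cexp S]; hence the sum of
   [m (iter n A (val i)) * expR (w i)] is at most [1]. *)
pose w i := a i - c - e2.
have Ag0 (i : D) : 0 <= m (iter n A (val i)).
  by apply: ms.1; apply: (iter_nonneg hA.1); exact: g0.
have mug0 (i : D) : 0 <= mu (val i) by apply: mus.1; exact: g0.
have mug1 : \sum_(i : D) mu (val i) = 1 by rewrite -linear_sum g1 mus.2.
apply: (@le_trans _ _ (\sum_(i : D) (m (iter n A (val i)) * expR (w i)
    - mu (val i) - mu (val i) * w i)%:E)%E).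
  by apply: lee_sum => i _; apply: lne_le_tangent; [exact: Ag0|exact: mug0].
rewrite sumEFin lee_fin.
have g1y y : \sum_(i : D) val i y = 1 by rewrite -cts_sumE g1 ctsE.
have h1 : \sum_(i : D) m (iter n A (val i)) * expR (a i - e2) <= expR c.
  have -> : \sum_(i : D) m (iter n A (val i)) * expR (a i - e2) =
      m (iter n A (\sum_(i : D) expR (a i - e2) *: val i)).
    rewrite !linear_sum; apply: eq_bigr => i _; rewrite !linearZ /=.
    by rewrite /GRing.scale /= mulrC.
  rewrite -(state_cst (expR c) ms); apply: state_le => // x.
  rewrite ctsE ctsE mulr1; apply: le_trans (AS x).
  apply: (iter_transfer_le hA) => y; rewrite cts_sumE -[leRHS]mulr1.
  rewrite -(g1y y) mulr_sumr.
  apply: ler_sum => i _; rewrite ctsE; have := g0 i y.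
  rewrite le_eqVlt => /predU1P[<-|giy]; first by rewrite !mulr0.
  rewrite ler_wpM2r ?(ltW giy)// cexpE ler_expR.
  by have := aP i y giy; rewrite ler_norml => /andP[]; lra.
have h2 : mu S - e2 <= \sum_(i : D) mu (val i) * a i.
  have -> : \sum_(i : D) mu (val i) * a i = mu (\sum_(i : D) a i *: val i).
    rewrite linear_sum; apply: eq_bigr => i _; rewrite linearZ /=.
    by rewrite /GRing.scale /= mulrC.
  rewrite -{1}(state_cst e2 mus) -linearB; apply: state_le => // y.
  rewrite cts_sumE !ctsE mulr1 -[leLHS]mulr1 -(g1y y) mulr_sumr.
  apply: ler_sum => i _; rewrite ctsE; have := g0 i y.
  rewrite le_eqVlt => /predU1P[<-|giy]; first by rewrite !mulr0.
  rewrite ler_wpM2r ?(ltW giy)//.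
  by have := aP i y giy; rewrite ler_norml => /andP[]; lra.
have -> : \sum_(i : D) (m (iter n A (val i)) * expR (w i) - mu (val i) -
      mu (val i) * w i) =
    expR (- c) * (\sum_(i : D) m (iter n A (val i)) * expR (a i - e2)) - 1 -
    (\sum_(i : D) mu (val i) * a i) + c + e2.
  rewrite (eq_bigr (fun i => expR (- c) * (m (iter n A (val i)) * expR (a i - e2))
      + (- mu (val i) + (- (mu (val i) * a i) + (c + e2) * mu (val i))))) => [|i _].
    by rewrite !big_split /= !sumrN -!mulr_sumr mug1; ring.
  have -> : expR (w i) = expR (- c) * expR (a i - e2).
    by rewrite -expRD /w; congr expR; ring.
  by rewrite /w; ring.
have : expR (- c) * (\sum_(i : D) m (iter n A (val i)) * expR (a i - e2)) <= 1.
  by rewrite expRN mulrC ler_pdivrMr ?expR_gt0// mul1r.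
have : e = e2 + e2 by rewrite /e2; field.
lra.
Qed.

Lemma birkhoff_invariant (mu : {scalar C(X, R)}) phi n :
  invariant_states delta mu -> mu (birkhoff delta phi n) = n%:R * mu phi.
Proof.
move=> [_ mui]; rewrite linear_sum mulr_natl -[X in _ *+ X](card_ord n).
rewrite -sumr_const; apply: eq_bigr => i _ /=.
by elim: (nat_of_ord i) => //= k; rewrite mui.
Qed.

(** Take [S = S_n phi] in [tau_n_le]; invariance gives [mu (S_n phi) = n * mu phi]. One [n] is
    enough, the t-entropy being an infimum. *)
Lemma t_entropy_le (mu : {scalar C(X, R)}) n phi (c : R) :
  invariant_states delta mu -> (0 < n)%N ->
  (forall x, iter n A (weight delta (cexp phi) n) x <= expR c) ->
  (t_entropy A mu <= (n%:R^-1 * c - mu phi)%:E)%E.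
Proof.
move=> mui n0 Aphi.
apply: (@le_trans _ _ ((n%:R^-1)%:E * tau_n A n mu)%E).
  by apply: ereal_inf_lbound; exists n.
have := @tau_n_le mu n (birkhoff delta phi n) c mui.1.
rewrite birkhoff_invariant// -weight_cexp => /(_ Aphi) h.
have n1 : 0 < (n%:R : R)^-1 by rewrite invr_gt0 ltr0n.
apply: le_trans (lee_wpmul2l _ h) _; first by rewrite lee_fin ltW.
rewrite -EFinM lee_fin mulrBr mulrA mulVf ?mul1r// pnatr_eq0.
by case: n n0 {Aphi h n1}.
Qed.

(** For each [n] and each partition, duality with [B = A^n] yields one state [m] that already makes
    the supremum at least [n * L]. *)
Lemma le_t_entropy (mu : {scalar C(X, R)}) (L : R) : states mu ->
  (forall n theta, (0 < n)%N -> (forall x, iter n A (cexp theta) x <= 1) ->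
    mu theta <= - (n%:R * L)) ->
  (L%:E <= t_entropy A mu)%E.
Proof.
move=> mus muL; apply: le_ereal_inf_tmp => _ [n /= n0 <-].
have n1 : 0 < (n%:R : R)^-1 by rewrite invr_gt0 ltr0n.
have -> : L%:E = ((n%:R^-1)%:E * (n%:R * L)%:E)%E.
  by rewrite -EFinM mulrA mulVf ?mul1r// gt_eqF// ltr0n.
apply: lee_wpmul2l; first by rewrite lee_fin ltW.
apply: le_ereal_inf_tmp => _ [D Dpou <-].
have [m ms mL] := @dual_bound X R cptX (iter n A) (iter_nonneg hA.1 n) D
  (fun i => val i) (fun i => Dpou.1 _ (valP i)) (partition_sum Dpou) mu _ mus
  (fun theta => muL n theta n0).
apply: le_trans mL _; apply: ereal_sup_ubound; exists m => //.
by rewrite big_seq_fsetE.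
Qed.

End entropy_bounds.

(** * Spectral radius *)

Section fekete.
Variables (R : realType) (s : nat -> R).
Hypothesis s0 : forall n, 0 <= s n.
Hypothesis sM : forall m n, s (m + n) <= s m * s n.

Lemma submult_pow k q r : s (q * k + r) <= s k ^+ q * s r.
Proof.
elim: q => [|q IH]; first by rewrite mul0n expr0 mul1r.
rewrite mulSn -addnA exprS -mulrA; apply: le_trans (sM _ _) _.
by rewrite ler_wpM2l.
Qed.

(** Write [n = q * k + r] with [r < k]. The part due to [r] is bounded, so [n * e] absorbs it. The
    exponential form admits [s k = 0]. *)
Lemma submult_eventually_le k a e : (0 < k)%N -> s k <= expR (k%:R * a) -> 0 < e ->
  \forall n \near \oo, s n <= expR (n%:R * (a + e)).
Proof.
move=> k0 ska e0.
have [C C1 CP] : exists2 C, 1 <= C & forall r, (r < k)%N -> s r <= C.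
  exists (1 + \sum_(i < k) s i) => [|r rk]; first by rewrite lerDl sumr_ge0.
  by rewrite (bigD1 (Ordinal rk))//= addrCA lerDl addr_ge0// sumr_ge0.
exists (Num.truncn ((k%:R * `|a| + ln C) / e)).+1 => // n /= nN.
have nbig : k%:R * `|a| + ln C <= n%:R * e.
  rewrite -ler_pdivrMr// ltW// (lt_le_trans (truncnS_gt _))// ler_nat//.
rewrite {1}(divn_eq n k); apply: le_trans (submult_pow _ _ _) _.
have rk : (n %% k < k)%N by rewrite ltn_pmod.
apply: (@le_trans _ _ (expR (k%:R * a) ^+ (n %/ k) * C)).
  by apply: ler_pM => //; [rewrite exprn_ge0|rewrite lerXn2r ?nnegrE ?expR_ge0|exact: CP].
have C0 : 0 < C by exact: lt_le_trans C1.
rewrite -{1}(@lnK _ C) ?posrE// -expRM_natr -expRD ler_expR.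
have nE : n%:R = (n %/ k)%:R * k%:R + (n %% k)%:R :> R.
  by rewrite -natrM -natrD -divn_eq.
have ra : - (k%:R * `|a|) <= (n %% k)%:R * a.
  have : `|(n %% k)%:R * a| <= k%:R * `|a|.
    by rewrite normrM ger0_norm// ler_wpM2r// ler_nat ltnW.
  by rewrite ler_norml => /andP[].
have -> : n%:R * (a + e) = (n %/ k)%:R * k%:R * a + (n %% k)%:R * a + n%:R * e.
  by rewrite mulrDr {1}nE mulrDl.
have -> : k%:R * a * (n %/ k)%:R = (n %/ k)%:R * k%:R * a by ring.
lra.
Qed.

Local Open Scope ereal_scope.

Lemma lne_root_le (y a : R) (n : nat) : (0 < n)%N -> (0 <= y)%R ->
  ((n%:R^-1)%:E * lne y%:E <= a%:E) = (y <= expR (n%:R * a))%R.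
Proof.
move=> n0; have n1 : (0 < (n%:R : R)^-1)%R by rewrite invr_gt0 ltr0n.
rewrite le_eqVlt => /predU1P[<-|y0].
  by rewrite le0_lneNy// mulrNy gtr0_sg// mul1e leNye expR_ge0.
rewrite lne_EFin// -EFinM lee_fin mulrC ler_pdivrMr ?ltr0n// mulrC.
by rewrite -[in LHS]ler_expR lnK// posrE.
Qed.

(** Each term is at least the infimum, and eventually the terms are below any larger real number.
    The infimum may be [-oo]; it is not [+oo] since the first term is not. *)
Lemma fekete :
  (n%:R^-1)%:E * lne (s n)%:E @[n --> \oo] -->
  ereal_inf [set (n%:R^-1)%:E * lne (s n)%:E | n in [set n | (0 < n)%N]].
Proof.
set u := fun n : nat => (n%:R^-1)%:E * lne (s n)%:E.
set S := [set u n | n in _].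
have Sle n : (0 < n)%N -> ereal_inf S <= u n.
  by move=> n0; apply: ereal_inf_lbound; exists n.
have ev (a e : R) : ereal_inf S < a%:E -> (0 < e)%R ->
    \forall n \near \oo, u n <= (a + e)%:E.
  move=> Sa e0; have [_ [k /= k0 <-] /ltW] := ereal_inf_lt Sa.
  rewrite lne_root_le// => ska.
  near=> n; rewrite lne_root_le//; near: n; last exact: nbhs_infty_gt.
  exact: submult_eventually_le ska e0.
have uNy n : (0 < n)%N -> u n < +oo.
  move=> n0; rewrite (@le_lt_trans _ _ (n%:R^-1 * ln (s n + 1))%:E) ?ltry//.
  rewrite lne_root_le// mulrA mulfV ?mul1r ?pnatr_eq0 -?lt0n//.
  by rewrite lnK ?lerDl// posrE ltr_wpDl.
case SE : (ereal_inf S) => [L| |].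
- apply/fine_cvgP; split.
    exists 1%N => // n /= n0; rewrite fin_numElt uNy// andbT.
    by rewrite (lt_le_trans _ (Sle _ n0))// SE ltNyr.
  apply/cvgrPdist_le => /= e e0.
  have := ev (L + e / 2)%R (e / 2)%R; rewrite SE lte_fin ltrDl divr_gt0// => /(_ isT isT).
  rewrite -addrA -splitr => h; near=> n.
  have n0 : (0 < n)%N by near: n; exact: nbhs_infty_gt.
  have un1 : u n <= (L + e)%:E by near: n.
  have := Sle n n0; rewrite SE; move: un1 (uNy n n0).
  case: (u n) => [r| |]//=; rewrite !lee_fin => r1 _ r2.
  by rewrite ler_distlC; apply/andP; split; lra.
- by have := Sle 1%N isT; rewrite SE leye_eq => /eqP uy; have := uNy 1%N isT; rewrite uy.
- apply/cvgeNyPle => a; have := ev (a - 1)%R 1%R; rewrite SE ltNyr ltr01 subrK.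
  exact.
Unshelve. all: by end_near. Qed.

End fekete.

Lemma lne_le (R : realType) (y a : R) : 0 <= y ->
  (lne y%:E <= a%:E)%E = (y <= expR a).
Proof.
by move=> y0; have := @lne_root_le R y a 1 isT y0; rewrite invr1 mul1e mul1r.
Qed.

(** * Norms of the powers of the weighted operator *)

Section spectral_radius.
Variables (X : ptopologicalType) (R : realType).
Hypothesis cptX : compact [set: X].
Variables (delta : {lrmorphism C(X, R) -> C(X, R)}).
Variables (A : {linear C(X, R) -> C(X, R)}).
Hypothesis hA : transfer_operator delta A.
Variable psi : C(X, R).
Hypothesis hpsi : nonneg psi.
Implicit Types (f g phi : C(X, R)) (x : X).

Let a n := iter n A (weight delta psi n).

(** A positive operator attains its norm at [1]: if [|f| <= 1], then [psi_n f] lies between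
    [- psi_n] and [psi_n]. *)
Lemma opnorm_iter_weighted n x0 : (forall x, a n x <= a n x0) ->
  opnorm (iter n (weighted A psi)) = (a n x0)%:E.
Proof.
move=> max0.
have w0 : nonneg (weight delta psi n) by exact: nonneg_weight.
have a0 x : 0 <= a n x by apply: (iter_nonneg hA.1).
apply/eqP; rewrite eq_le; apply/andP; split.
  apply: ge_ereal_sup => _ [f /= f1 <-]; apply: ge_ereal_sup => _ [x _ <-].
  have {}f1 y : `|f y| <= 1.
    rewrite -lee_fin; apply: le_trans f1; apply: ereal_sup_ubound.
    by exists y.
  rewrite lee_fin (iter_weighted hA); apply: le_trans (max0 x).
  have h g : (forall y, g y <= weight delta psi n y) -> iter n A g x <= a n x.
    by move=> gw; exact: (iter_transfer_le hA).
  rewrite ler_norml; apply/andP; split; last first.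
    by apply: h => y; rewrite ctsE ler_piMr// (le_trans (ler_norm _)).
  have -> : iter n A (weight delta psi n * f) x =
      - iter n A (- (weight delta psi n * f)) x.
    by rewrite linearN ctsE opprK.
  rewrite lerN2; apply: h => y; rewrite !ctsE -mulrN ler_piMr//.
  by rewrite (le_trans (ler_norm _))// normrN.
apply: (@le_trans _ _ (cnorm (iter n (weighted A psi) 1))).
  apply: ereal_sup_ubound; exists x0 => //.
  by rewrite (iter_weighted hA) mulr1 ger0_norm// a0.
apply: ereal_sup_ubound; exists 1 => //=; apply: ge_ereal_sup => _ [x _ <-].
by rewrite ctsE normr1.
Qed.

Lemma weight_add m n : weight delta psi (m + n) =
  iter n delta (weight delta psi m) * weight delta psi n.
Proof.
rewrite /weight addnC big_split_ord /= mulrC rmorph_prod; congr (_ * _).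
by apply: eq_bigr => i _; rewrite /= iterD.
Qed.

(** With [s n] the maximum of [a n], submultiplicativity follows from
    [a (m + n) = A^m (psi_m * a n)], an instance of the transfer identity. *)
Lemma exists_spectral_sequence : exists s : nat -> R,
  [/\ forall n x, a n x <= s n, forall n, exists x, a n x = s n,
      forall n, 0 <= s n &
      log_spectral_radius (weighted A psi) = ereal_inf
        [set (n%:R^-1)%:E * lne (s n)%:E | n in [set n | (0 < n)%N]]%E].
Proof.
have [xs xsP] := choice (fun n => cts_max cptX (a n)).
pose s n := a n (xs n).
have s0 n : 0 <= s n.
  by apply: (iter_nonneg hA.1); exact: nonneg_weight.
exists s; split => //; first by move=> n; exists (xs n).
rewrite /log_spectral_radius; under eq_fun do rewrite (opnorm_iter_weighted (xsP _)).
apply/cvg_lim => //; apply: fekete => // m n.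
rewrite /s {1}/a iterD weight_add iter_transfer//.
apply: (@le_trans _ _ (iter m A (a n (xs n) *: weight delta psi m) (xs (m + n)%N))).
  apply: (iter_transfer_le hA) => y; rewrite !ctsE mulrC ler_wpM2r//.
    exact: nonneg_weight.
  exact: xsP.
by rewrite linearZ /= ctsE mulrC ler_wpM2r; [exact: isT|exact: s0|exact: xsP].
Qed.

(** Used to replace [psi] by the strictly positive [psi + e], which has a logarithm in the algebra,
    at a cost linear in [e]. *)
Lemma weight_perturb n : exists2 K, 0 <= K & forall e, 0 <= e <= 1 -> forall x,
  weight delta (psi + e *: 1) n x <= weight delta psi n x + e * K.
Proof.
elim: n => [|n [K K0 IH]].
  by exists 0 => // e _ x; rewrite /weight !big_ord0 mulr0 addr0.
have [b b0 bP] := cts_bounded cptX (weight delta psi n).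
have [c c0 cP] := cts_bounded cptX (iter n delta psi).
exists (b + K * c + K) => [|e /[dup] /andP[e0 e1] /IH{}IH x].
  by rewrite !addr_ge0 ?mulr_ge0.
have wS p : weight delta p n.+1 x = weight delta p n x * iter n delta p x.
  by rewrite /weight big_ord_recr ctsE.
rewrite !wS.
have -> : iter n delta (psi + e *: 1) x = iter n delta psi x + e.
  by rewrite linearD linearZ rmorph1 !ctsE mulr1.
set d := iter n delta psi x; set W := weight delta psi n x.
have d0 : 0 <= d by exact: iter_endo_nonneg.
have W0 : 0 <= W by exact: nonneg_weight.
have dc : d <= c by exact: le_trans (ler_norm _) (cP x).
have Wb : W <= b by exact: le_trans (ler_norm _) (bP x).
apply: (@le_trans _ _ ((W + e * K) * (d + e))).
  by rewrite ler_wpM2r ?addr_ge0// IH.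
have -> : (W + e * K) * (d + e) = W * d + e * (W + K * d + e * K) by ring.
rewrite lerD2l ler_wpM2l// lerD//; last by rewrite ler_piMl.
by rewrite lerD// ler_wpM2l.
Qed.

End spectral_radius.

(** * Riesz representation *)

Section riesz_outer_measure.
Variables (X : ptopologicalType) (R : realType).
Hypotheses (cptX : compact [set: X]) (hX : hausdorff_space X).
Variable Lam : {scalar C(X, R)}.
Hypothesis Lams : states Lam.
Implicit Types (f g h : C(X, R)) (x : X) (U V E : set X).

Definition below U : set C(X, R) :=
  [set f | (forall x, 0 <= f x <= 1) /\ forall x, ~ U x -> f x = 0].

Lemma below0 U : below U 0.
Proof. by split=> // x; rewrite ctsE lexx ler01. Qed.

Lemma open_cts_gt f (a : R) : open [set x | a < f x].
Proof.
by apply: (@open_comp X R f [set t | a < t]) => // x _; exact: cts_fun.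
Qed.

Lemma open_cts_lt f (a : R) : open [set x | f x < a].
Proof.
by apply: (@open_comp X R f [set t | t < a]) => // x _; exact: cts_fun.
Qed.

Lemma exists_below_point U x : open U -> U x -> exists2 f, below U f & f x = 1.
Proof.
move=> oU Ux.
have /(_ R [set x] (~` U)) := (normal_separatorP (T := X)).1 (compact_normal hX cptX).
have clx : closed [set x] by exact: accessible_closed_set1 (hausdorff_accessible hX) _.
move=> /(_ clx (open_closedC oU)).
have -> : [set x] `&` ~` U = set0.
  by apply/seteqP; split => // y [/= ->].
move=> /(_ erefl) /(uniform_separatorP (R := R))[f [cf f01 f0 f1]].
pose F : C(X, R) := mkcts cf; have FE y : (1 - F) y = 1 - f y by [].
exists (1 - F); last first.
  have fx0 : f x = 0 by apply: f0; exists x.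
  by rewrite FE fx0 subr0.
split=> y; rewrite FE.
  have : `[0, 1]%classic (f y) by apply: f01; exists y.
  by rewrite /= in_itv /= => /andP[? ?]; apply/andP; split; lra.
move=> nUy; have -> : f y = 1 by apply: f1; exists y.
by rewrite subrr.
Qed.

Definition cmax f g : C(X, R) := 2^-1 *: (f + g + cabs (f - g)).

Lemma cmaxE f g x : cmax f g x = Num.max (f x) (g x).
Proof. by rewrite /cmax !ctsE cabsE !ctsE maxr_absE; field. Qed.

Lemma below_max U f g : below U f -> below U g -> below U (cmax f g).
Proof.
move=> [f01 fU] [g01 gU]; split=> x; rewrite cmaxE.
  by case: (leP (f x) (g x)) => _; [exact: g01|exact: f01].
by move=> nUx; rewrite fU// gU// maxxx.
Qed.

(* Dini: finite sums of functions below the [U i] form an upward directed family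
   whose pointwise supremum is at least [f]. *)
Lemma below_bigcup_approx (U : nat -> set X) f (e : R) : (forall i, open (U i)) ->
  below (\bigcup_i U i) f -> 0 < e ->
  exists n (F : nat -> C(X, R)), (forall i, below (U i) (F i)) /\
    forall x, f x - e <= \sum_(i < n) F i x.
Proof.
move=> oU [f01 fU] e0.
pose fam := (nat * (nat -> C(X, R)))%type.
pose good (p : fam) := forall i, below (U i) (p.2 i).
pose S (p : fam) : C(X, R) := \sum_(i < p.1) p.2 i.
have F0 (p : fam) i x : good p -> 0 <= p.2 i x by move=> /(_ i)[/(_ x)/andP[]].
have join (p q : fam) : good p -> good q -> exists2 r : fam, good r &
    forall x, S p x <= S r x /\ S q x <= S r x.
  move=> gp gq; exists (maxn p.1 q.1, fun i => cmax (p.2 i) (q.2 i)).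
    by move=> i; exact: below_max.
  have mono (a : fam) m x : good a -> (a.1 <= m)%N -> (forall i, a.2 i x <=
      cmax (p.2 i) (q.2 i) x) -> S a x <= \sum_(i < m) cmax (p.2 i) (q.2 i) x.
    move=> ga am al; rewrite cts_sumE -(subnKC am) big_split_ord /= -[leLHS]addr0.
    apply: lerD; first by apply: ler_sum.
    apply: sumr_ge0 => i _; apply: le_trans (al _); exact: F0.
  move=> x; have -> : S (maxn p.1 q.1, fun i => cmax (p.2 i) (q.2 i)) x =
      \sum_(i < maxn p.1 q.1) cmax (p.2 i) (q.2 i) x by rewrite cts_sumE.
  split; apply: mono => //.
  - exact: leq_maxl.
  - by move=> i; rewrite cmaxE le_max lexx.
  - exact: leq_maxr.
  - by move=> i; rewrite cmaxE le_max lexx orbT.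
have cover_open (p : fam) : good p -> open [set x | - e < (S p - f) x].
  by move=> _; exact: open_cts_gt.
have := cptX; rewrite compact_cover => /(_ fam [set p | good p]
  (fun p => [set x | - e < (S p - f) x]) cover_open)[x _|D Dgood Dcov].
  have [[i _ Uix]|nUx] := pselect ((\bigcup_i U i) x); last first.
    exists (0%N, fun=> 0); first by move=> i; exact: below0.
    by rewrite /= !ctsE /S big_ord0 ctsE fU// subrr oppr_lt0.
  have [g gU gx] := exists_below_point (oU i) Uix.
  exists (i.+1, fun j => if j == i then g else 0).
    by move=> j /=; case: eqP => [->|_]; [exact: gU|exact: below0].
  rewrite /= !ctsE; have -> : S (i.+1, fun j => if j == i then g else 0) x = 1.
    rewrite cts_sumE big_ord_recr /= eqxx gx big1 ?add0r// => j _.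
    by rewrite ltn_eqF// ctsE.
  by have /andP[_ fx1] := f01 x; lra.
have [r gr rP] : exists2 r, good r & forall p, p \in D -> forall x, S p x <= S r x.
  have {}Dgood p : p \in enum_fset D -> good p by move=> /Dgood; rewrite inE.
  suff [r gr rP] : exists2 r, good r &
      forall p, p \in enum_fset D -> forall x, S p x <= S r x by exists r.
  elim: (enum_fset D) Dgood => [|p s IH] sg.
    by exists (0%N, fun=> 0) => // i; exact: below0.
  have [q qs|r gr rP] := IH; first by apply: sg; rewrite inE qs orbT.
  have [|t gt tP] := join p r _ gr; first by apply: sg; rewrite inE eqxx.
  exists t => // q; rewrite inE => /predU1P[-> x|/rP h x].
    exact: (tP x).1.
  exact: le_trans (h x) (tP x).2.
exists r.1, r.2; split => // x; rewrite -cts_sumE -/(S r).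
have [p pD /=] := Dcov x I; rewrite !ctsE => h.
by have := rP p pD x; lra.
Qed.

Local Open Scope ereal_scope.

Definition open_content U : \bar R := ereal_sup [set (Lam f)%:E | f in below U].

Definition riesz_outer E : \bar R :=
  ereal_inf [set open_content U | U in [set U : set X | open U /\ E `<=` U]].

Lemma le_open_content U f : below U f -> (Lam f)%:E <= open_content U.
Proof. by move=> fU; apply: ereal_sup_ubound; exists f. Qed.

Lemma open_content_ge0 U : 0 <= open_content U.
Proof.
by apply: le_trans (le_open_content (below0 U)); rewrite linear0 lexx.
Qed.

Lemma open_content_le1 U : open_content U <= 1.
Proof.
apply: ge_ereal_sup => _ [f [f01 _] <-]; rewrite lee_fin -Lams.2.
by apply: state_le => // x; have /andP[] := f01 x; rewrite ctsE.
Qed.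

Lemma open_content_homo U V : U `<=` V -> open_content U <= open_content V.
Proof.
move=> UV; apply: ge_ereal_sup => _ [f [f01 fU] <-]; apply: le_open_content.
by split => // x nVx; apply: fU => /UV.
Qed.

Lemma open_content_sigma_subadditive (U : nat -> set X) : (forall i, open (U i)) ->
  open_content (\bigcup_i U i) <= \sum_(i <oo) open_content (U i).
Proof.
move=> oU; apply: ge_ereal_sup => _ [f fU <-]; apply/lee_addgt0Pr => e e0.
have [n [F [FU Ff]]] := below_bigcup_approx oU fU e0.
apply: (@le_trans _ _ (\sum_(0 <= i < n) (Lam (F i))%:E + e%:E)).
  rewrite big_mkord sumEFin -EFinD lee_fin -linear_sum -lerBlDr.
  rewrite -{1}(state_cst e Lams) -linearB; apply: state_le => // x.
  by rewrite cts_sumE !ctsE mulr1.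
rewrite leeD2r//; apply: le_trans (nneseries_lim_ge n _); last first.
  by move=> *; exact: open_content_ge0.
by apply: lee_sum => i _; exact: le_open_content.
Qed.

Lemma riesz_outer_open U : open U -> riesz_outer U = open_content U.
Proof.
move=> oU; apply/eqP; rewrite eq_le; apply/andP; split.
  by apply: ereal_inf_lbound; exists U => //; split.
by apply: le_ereal_inf_tmp => _ [V [oV UV] <-]; exact: open_content_homo.
Qed.

Lemma riesz_outer_ge0 E : 0 <= riesz_outer E.
Proof. by apply: le_ereal_inf_tmp => _ [U _ <-]; exact: open_content_ge0. Qed.

Lemma riesz_outer_le1 E : riesz_outer E <= 1.
Proof.
apply: le_trans (open_content_le1 setT); apply: ereal_inf_lbound.
by exists setT => //; split => //; exact: openT.
Qed.

Lemma riesz_outer_fin_num E : riesz_outer E \is a fin_num.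
Proof.
by rewrite ge0_fin_numE ?riesz_outer_ge0// (le_lt_trans (riesz_outer_le1 _)) ?ltry.
Qed.

Lemma riesz_outer0 : riesz_outer set0 = 0.
Proof.
apply/eqP; rewrite eq_le riesz_outer_ge0 andbT riesz_outer_open; last exact: open0.
apply: ge_ereal_sup => _ [f [_ f0] <-].
by rewrite (_ : f = 0%R) ?linear0//; apply: ctsP => x; rewrite f0// ctsE.
Qed.

Lemma riesz_outer_homo : {homo riesz_outer : A B / A `<=` B >-> A <= B}.
Proof.
move=> A B AB; apply: le_ereal_inf_tmp => _ [U [oU BU] <-].
by apply: ereal_inf_lbound; exists U => //; split => //; exact: subset_trans BU.
Qed.

Lemma riesz_outer_sigma_subadditive : sigma_subadditive riesz_outer.
Proof.
move=> F; apply/lee_addgt0Pr => e e0.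
have /choice[U UP] : forall n, exists U, [/\ open U, F n `<=` U &
    open_content U <= riesz_outer (F n) + (e / (2 ^ n.+1)%:R)%:E].
  move=> n; have en : (0 < e / (2 ^ n.+1)%:R)%R.
    by rewrite divr_gt0// ltr0n expn_gt0.
  have [_ [U [oU FU] <-] /ltW h] := lb_ereal_inf_adherent en (riesz_outer_fin_num (F n)).
  by exists U.
apply: (@le_trans _ _ (open_content (\bigcup_n U n))).
  apply: ereal_inf_lbound; exists (\bigcup_n U n) => //; split.
    by apply: bigcup_open => i _; have [] := UP i.
  by apply: subset_bigcup => i _; have [] := UP i.
apply: le_trans (open_content_sigma_subadditive _) _.
  by move=> i; have [] := UP i.
apply: le_trans (epsilon_trick xpredT (fun n => riesz_outer_ge0 (F n)) (ltW e0)).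
apply: lee_nneseries => [n _ _|n _]; first exact: open_content_ge0.
by have [] := UP n.
Qed.

(** For [f] below [U] and [V], the set where [f < e] is an open neighbourhood of [E] minus [V]. A
    function [g] below its trace on [U] can be added to the positive part of [f - e], and the sum is
    still below [U]. *)
Lemma riesz_outer_open_additive E V : open V ->
  riesz_outer (E `&` V) + riesz_outer (E `&` ~` V) <= riesz_outer E.
Proof.
move=> oV; apply: le_ereal_inf_tmp => _ [U [oU EU] <-].
have q_fin := riesz_outer_fin_num (E `&` ~` V).
have r_fin : open_content U \is a fin_num.
  by rewrite -riesz_outer_open//; exact: riesz_outer_fin_num.
rewrite -leeBrDr//; apply: (@le_trans _ _ (open_content (U `&` V))).
  apply: ereal_inf_lbound; exists (U `&` V) => //; split; first exact: openI.
  by move=> x [/EU ? ?].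
apply: ge_ereal_sup => _ [f [f01 fUV] <-].
rewrite -(fineK q_fin) -(fineK r_fin) -EFinB lee_fin.
apply/ler_addgt0Pr => e e0; rewrite -lerBlDr lerBrDr -lerBrDl.
rewrite -lee_fin (fineK q_fin).
apply: (@le_trans _ _ (open_content (U `&` [set x | (f x < e)%R]))).
  apply: ereal_inf_lbound; exists (U `&` [set x | (f x < e)%R]) => //; split.
    by apply: openI => //; exact: open_cts_lt.
  by move=> x [/EU Ux nVx]; split => //=; rewrite fUV// => -[].
apply: ge_ereal_sup => _ [g [g01 gW] <-].
rewrite lee_fin lerBrDl -lee_fin (fineK r_fin).
pose f' : C(X, R) := cmax (f - e *: 1)%R 0%R.
have f'E x : (f' x = Num.max (f x - e) 0)%R by rewrite cmaxE !ctsE mulr1.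
apply: (@le_trans _ _ (Lam (f' + g)%R)%:E).
  rewrite lee_fin linearD lerD2r -{1}(state_cst e Lams) -linearB.
  by apply: state_le => // x; rewrite f'E !ctsE mulr1 le_max lexx.
apply: le_open_content; split=> x; rewrite ctsE f'E.
  have /andP[g0 g1] := g01 x; have /andP[f0 f1] := f01 x.
  have [[_ /= fe]|nW] := pselect ((U `&` [set x | (f x < e)%R]) x).
    by rewrite max_r ?add0r ?g0//; lra.
  rewrite gW// addr0; case: (leP (f x - e)%R 0%R) => ?; first by rewrite lexx ler01.
  by apply/andP; split; lra.
move=> nUx; rewrite gW => [|[]//]; rewrite fUV => [|[]//].
by rewrite addr0 max_r//; lra.
Qed.

End riesz_outer_measure.

Local Arguments lne : simpl never.

(** * Borel integrals of continuous functions and of [ln psi] *)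

Section borel_integral.
Variables (X : ptopologicalType) (R : realType).
Hypothesis cptX : compact [set: X].
Variable P : probability (borel X) R.
Implicit Types (f g : C(X, R)) (U : set X).

Lemma borel_open U : open U -> measurable (U : set (borel X)).
Proof. by move=> oU; exact: sub_sigma_algebra. Qed.

Lemma cts_measurable f : measurable_fun [set: borel X] (f : borel X -> R).
Proof.
move=> mT; apply: (measurability _ (RGenOInfty.measurableE R)) => // _ [_ [a ->] <-].
rewrite setTI; apply: borel_open.
rewrite [X in open X](_ : _ = [set x | a < f x]); first exact: open_cts_gt.
by apply/seteqP; split => x /=; rewrite in_itv /= andbT.
Qed.

Lemma cts_integrable f : P.-integrable [set: borel X] (fun x => (f x)%:E).
Proof.
apply: (@measurable_bounded_integrable _ _ _ P (f : borel X -> R)) => //.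
- by rewrite [ltLHS](probability_setT P) ltry.
- exact: cts_measurable.
have [b b0 fb] := cts_bounded cptX f.
by exists b; split; rewrite ?num_real// => M bM x _; exact: le_trans (fb x) (ltW bM).
Qed.

Lemma cts_integral_linear (a : R) f g :
  (\int[P]_x ((a *: f + g)%R x)%:E = a%:E * \int[P]_x (f x)%:E + \int[P]_x (g x)%:E)%E.
Proof.
rewrite -integralZl//; last exact: cts_integrable.
rewrite -integralD//; first by apply: integrableZl => //; exact: cts_integrable.
exact: cts_integrable.
Qed.

Lemma cts_integral_cst (c : R) : (\int[P]_x ((c *: 1 : C(X, R))%R x)%:E = c%:E)%E.
Proof.
rewrite (eq_integral (cst c%:E)) => [|x _]; last by rewrite ctsE ctsE mulr1.
by rewrite integral_cst// [X in (_ * X)%E](probability_setT P) mule1.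
Qed.

Local Open Scope ereal_scope.

Variable psi : C(X, R).
Hypothesis hpsi : nonneg psi.

Lemma lne_measurable :
  measurable_fun [set: borel X] ((fun x => lne (psi x)%:E) : borel X -> \bar R).
Proof.
move=> mT; apply: (measurability _ (ErealGenOInfty.measurableE R)) => // _ [_ [a ->] <-].
rewrite setTI; apply: borel_open.
rewrite [X in open X](_ : _ = [set x | (expR a < psi x)%R]); first exact: open_cts_gt.
apply/seteqP; split => x /=; rewrite in_itv /= andbT.
  by rewrite !ltNge lne_le.
by rewrite !ltNge lne_le.
Qed.

(** The integral of [ln psi] may be [-oo], so the positive and the negative parts are compared
    separately. *)
Lemma integral_lne_le phi : (forall x, psi x <= cexp phi x)%R ->
  \int[P]_x lne (psi x)%:E <= \int[P]_x (phi x)%:E.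
Proof.
move=> pphi.
have le x : lne (psi x)%:E <= (phi x)%:E by rewrite lne_le.
have mphi : measurable_fun [set: borel X] ((fun x => (phi x)%:E) : borel X -> \bar R).
  by apply/measurable_EFinP; exact: cts_measurable.
rewrite integralE [leRHS]integralE leeB//.
- apply: ge0_le_integral => //.
  + by apply: measurable_funepos; exact: lne_measurable.
  + exact: measurable_funepos.
  + by move=> x _; apply: (@funepos_le _ _ setT) => [y _|]; [exact: le|rewrite inE].
- apply: ge0_le_integral => //.
  + exact: measurable_funeneg.
  + by apply: measurable_funeneg; exact: lne_measurable.
  + by move=> x _; apply: (@funeneg_le _ _ setT) => [y _|]; [exact: le|rewrite inE].
Qed.

(** Monotone convergence, applied to [C - phi k] so that the functions are nonnegative and
    increasing. *)
Lemma integral_lne_ge (b : R) :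
  (forall phi, (forall x, psi x <= cexp phi x)%R -> b%:E <= \int[P]_x (phi x)%:E) ->
  b%:E <= \int[P]_x lne (psi x)%:E.
Proof.
move=> bphi.
have [c c0 psic] := cts_bounded cptX psi.
have /choice[phi phiE] : forall k : nat, exists phi : C(X, R),
    cexp phi = cmax psi (expR (- k%:R) *: 1)%R.
  move=> k; apply: exists_cln => x; rewrite cmaxE lt_max !ctsE mulr1.
  by rewrite expR_gt0 orbT.
(* A common upper bound of all [phi k]: both [psi] and [expR (- k)] are at most [c + 1]. *)
pose C := ln (c + 1)%R.
have phiex k x : expR (phi k x) = Num.max (psi x) (expR (- k%:R))%R.
  by rewrite -cexpE phiE cmaxE !ctsE mulr1.
have phiC k x : (phi k x <= C)%R.
  rewrite -ler_expR phiex lnK ?posrE ?ltr_wpDl// ge_max; apply/andP; split.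
    by rewrite (le_trans (ler_norm _))// (le_trans (psic x))// lerDl.
  by rewrite (@le_trans _ _ 1%R) ?lerDr// expR_le1 oppr_le0.
(* [phi k] is [ln] of [psi] truncated below at [expR (- k)], so that [G k]
   increases to [C - ln psi]. *)
pose G k (x : borel X) : \bar R := (C - phi k x)%:E.
have G0 k x : 0 <= G k x by rewrite lee_fin subr_ge0.
have Gnd x : nondecreasing_seq (G ^~ x).
  move=> m n mn; rewrite lee_fin lerD2l lerN2 -ler_expR !phiex.
  by rewrite ge_max !le_max lexx ler_expR lerN2 ler_nat mn orbT.
have mG k : measurable_fun [set: borel X] (G k).
  apply/measurable_EFinP; apply: measurable_funB; first exact: measurable_cst.
  exact: cts_measurable.
have intG k : \int[P]_x G k x <= (C - b)%:E.
  have -> : \int[P]_x G k x = (-1)%:E * \int[P]_x (phi k x)%:E + C%:E.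
    rewrite -(cts_integral_cst C) -cts_integral_linear.
    by apply: eq_integral => x _; rewrite /G !ctsE mulr1 mulN1r addrC.
  have fi : \int[P]_x (phi k x)%:E \is a fin_num.
    by apply: integrable_fin_num => //; exact: cts_integrable.
  have := bphi (phi k); rewrite -(fineK fi) -EFinM -EFinD !lee_fin => h.
  rewrite mulN1r addrC lerD2l lerN2; apply: h => x.
  by rewrite cexpE phiex le_max lexx.
pose H (x : borel X) : \bar R := C%:E - lne (psi x)%:E.
have lneC x : lne (psi x)%:E <= C%:E.
  rewrite lne_le// lnK ?posrE ?ltr_wpDl//.
  by rewrite (le_trans (ler_norm _))// (le_trans (psic x))// lerDl.
have H0 x : 0 <= H x.
  rewrite /H; case: (lne (psi x)%:E) (lneC x) => [r| |] h //.
    by rewrite -EFinB lee_fin subr_ge0 -lee_fin.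
  by rewrite leey.
have mH : measurable_fun [set: borel X] H.
  by apply: emeasurable_funB; [exact: measurable_cst|exact: lne_measurable].
have limG x : H x <= limn (G ^~ x).
  have Gle k : G k x <= limn (G ^~ x).
    rewrite (cvg_lim _ (ereal_nondecreasing_cvgn (Gnd x)))//.
    by apply: ereal_sup_ubound; exists k.
  have := hpsi x; rewrite le_eqVlt => /predU1P[px|px].
    rewrite [leRHS](_ : _ = +oo) ?leey//; apply: eq_infty => r.
    apply: le_trans (Gle (Num.truncn (r - C)).+1); rewrite lee_fin.
    have -> : phi (Num.truncn (r - C)).+1 x = (- (Num.truncn (r - C)).+1%:R)%R.
      by apply: expR_inj; rewrite phiex -px max_r ?expR_ge0.
    by rewrite opprK -lerBlDl; exact/ltW/truncnS_gt.
  rewrite /H lne_EFin//; apply: le_trans (Gle (Num.truncn (- ln (psi x))).+1).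
  rewrite lee_fin lerD2l lerN2 -ler_expR phiex lnK ?posrE// ge_max lexx /=.
  rewrite -[leRHS](@lnK _ (psi x)) ?posrE// ler_expR lerNl.
  exact/ltW/truncnS_gt.
have intH : \int[P]_x H x <= (C - b)%:E.
  apply: (@le_trans _ _ (\int[P]_x limn (G ^~ x))).
    apply: ge0_le_integral => //.
    apply: (emeasurable_fun_cvg G) => // x _.
    exact: ereal_nondecreasing_is_cvgn.
  rewrite monotone_convergence//.
  apply: lime_le; last by apply: nearW => k; exact: intG.
  apply: ereal_nondecreasing_is_cvgn => m n mn.
  by apply: ge0_le_integral => // x _; exact: Gnd.
(* The bound on the integral makes [H] integrable, so [ln psi = C - H] can be integrated term by
   term; where [psi = 0], both sides are [-oo]. *)
have iH : P.-integrable [set: borel X] H.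
  apply/integrableP; split => //.
  rewrite (eq_integral H) => [|x _]; last by rewrite gee0_abs.
  by rewrite (le_lt_trans intH)// ltry.
have -> : \int[P]_x lne (psi x)%:E = \int[P]_x (cst C%:E \- H) x.
  apply: eq_integral => x _ /=; rewrite /H.
  case: (lne (psi x)%:E) (lneC x) => [r| |]//= _.
  by rewrite -!EFinB; congr EFin; ring.
rewrite integralB//; last first.
  by apply: finite_measure_integrable_cst.
rewrite integral_cst// [X in (_ * X)](probability_setT P) mule1.
have fH : \int[P]_x H x \is a fin_num by exact: integrable_fin_num.
by move: intH; rewrite -(fineK fH) -EFinB !lee_fin; lra.
Qed.
End borel_integral.

(** * The regular Borel probability representing a state *)

Section riesz_representation.
Variables (X : ptopologicalType) (R : realType).
Hypotheses (cptX : compact [set: X]) (hX : hausdorff_space X).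
Variable Lam : {scalar C(X, R)}.
Hypothesis Lams : states Lam.
Implicit Types (f g h : C(X, R)) (x : X) (U V E : set X).

Lemma clamp_sum n (t : R) : 0 <= t ->
  \sum_(k < n) (if t - k%:R <= 0 then 0 else if t - k%:R <= 1 then t - k%:R else 1) =
  Num.min t n%:R.
Proof.
move=> t0; elim: n => [|n IH]; first by rewrite big_ord0 min_r.
rewrite big_ord_recr /= IH -natr1; case: (leP (t - n%:R) 0) => h1.
  by rewrite !min_l; lra.
case: (leP (t - n%:R) 1) => h2; first by rewrite min_r ?min_l; lra.
by rewrite !min_r; lra.
Qed.

Local Open Scope ereal_scope.

Let outer : set X -> \bar R := riesz_outer Lam.

Lemma caratheodory_borel (mu : {outer_measure set X -> \bar R}) :
  (forall V, open V -> mu.-caratheodory V) ->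
  forall B : set (borel X), measurable B -> mu.-caratheodory B.
Proof.
move=> oc; apply: smallest_sub => //; split.
- exact: caratheodory_measurable_set0.
- by move=> A mA; rewrite setTD; exact: caratheodory_measurable_setC.
- by move=> F mF; exact: caratheodory_measurable_bigcup.
Qed.

Lemma exists_riesz_probability : exists P : probability (borel X) R,
  forall B : set (borel X), P B = riesz_outer Lam B.
Proof.
pose mu : {outer_measure set X -> \bar R} := HB.pack outer
  (isOuterMeasure.Build R X outer (riesz_outer0 Lam) (riesz_outer_ge0 Lam)
    (@riesz_outer_homo X R Lam) (riesz_outer_sigma_subadditive cptX hX Lams)).
have mc : forall B : set (borel X), measurable B -> mu.-caratheodory B.
  apply: caratheodory_borel => V oV; apply: le_caratheodory_measurable => E.
  exact: riesz_outer_open_additive.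
have ssa : semi_sigma_additive (outer : set (borel X) -> \bar R).
  move=> F mF tF mUF; apply: (caratheodory_measure_sigma_additive (mu := mu)) => //.
    by move=> i; exact: mc.
  exact: mc.
pose isM := isMeasure.Build _ (borel X) R (outer : set (borel X) -> \bar R)
  (riesz_outer0 Lam) (riesz_outer_ge0 Lam) ssa.
pose M : {measure set (borel X) -> \bar R} :=
  HB.pack (outer : set (borel X) -> \bar R) isM.
have M1 : M [set: borel X] = 1.
  apply/eqP; rewrite eq_le riesz_outer_le1//= [leRHS]riesz_outer_open; last exact: openT.
  have <- : (Lam 1%R)%:E = 1 by rewrite Lams.2.
  by apply: le_open_content; split=> [x|x /(_ I)//]; rewrite ctsE ler01 lexx.
pose P : probability (borel X) R := HB.pack (outer : set (borel X) -> \bar R) isM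
  (Measure_isProbability.Build _ _ _ M M1).
by exists P.
Qed.

Variable P : probability (borel X) R.
Hypothesis PE : forall B : set (borel X), P B = riesz_outer Lam B.

(** Outer regularity is built into the outer measure. Inner regularity is outer regularity of the
    complement, as closed subsets of [X] are compact. *)
Lemma riesz_regular : regular_measure P.
Proof.
move=> B mB; split.
  rewrite PE /riesz_outer; congr ereal_inf; apply/seteqP; split => [_ [U [oU BU] <-]|_ [U [oU BU] <-]];
    by exists U => //; rewrite PE riesz_outer_open.
apply/eqP; rewrite eq_le; apply/andP; split; last first.
  apply: ge_ereal_sup => _ [K [cK KB] <-]; rewrite !PE; exact: riesz_outer_homo.
apply/lee_addgt0Pr => e e0.
have [_ [U [oU BU] <-] /ltW h] := lb_ereal_inf_adherent e0
  (riesz_outer_fin_num Lams (~` B)).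
have mU : measurable (U : set (borel X)) by exact: borel_open.
have cK : compact (~` U).
  by apply: (subclosed_compact _ cptX) => //; exact: open_closedC.
have KB : ~` U `<=` B by rewrite -[B]setCK; exact: subsetC.
apply: (@le_trans _ _ (P (~` U : set (borel X)) + e%:E)); last first.
  by rewrite leeD2r//; apply: ereal_sup_ubound; exists (~` U).
move: h; rewrite -/(riesz_outer Lam (~` B)) -riesz_outer_open// -!PE.
rewrite [P (~` U)]probability_setC//.
have -> : P (~` B) = 1 - P B by rewrite [LHS]probability_setC.
have fB : P B \is a fin_num by rewrite PE; exact: riesz_outer_fin_num.
have fU : P U \is a fin_num by rewrite PE; exact: riesz_outer_fin_num.
by rewrite -(fineK fB) -(fineK fU) -!EFinB -!EFinD !lee_fin; lra.
Qed.

(** A layer decomposition: [N f] is the sum of clamps [c k] below [V k = {N f > k}], so [N * Lam f]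
    is at most the sum of the [P (V k)]. The indicators of the [V k] add up to at most [N f + 1];
    divide by [N] and let it grow. *)
Lemma riesz_integral_ge01 f : (forall x, 0 <= f x <= 1)%R ->
  (Lam f)%:E <= \int[P]_x (f x)%:E.
Proof.
move=> f01; have fI : \int[P]_x (f x)%:E \is a fin_num.
  by apply: integrable_fin_num => //; exact: cts_integrable.
rewrite -(fineK fI) lee_fin; set J := fine _.
suff main n : (n.+1%:R * Lam f <= n.+1%:R * J + 1)%R.
  apply/ler_addgt0Pr => e e0.
  have := main (Num.truncn e^-1); set n := (Num.truncn e^-1).+1 => h.
  have n0 : (0 < (n%:R : R))%R by rewrite ltr0n.
  have en : (1 <= n%:R * e)%R.
    by rewrite -ler_pdivrMr// mul1r; exact/ltW/truncnS_gt.
  by rewrite -(ler_pM2l n0); lra.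
set N := n.+1.
pose V k := [set x | (k%:R < (N%:R *: f) x)%R].
have oV k : open (V k) by exact: open_cts_gt.
pose c k := clamp (N%:R *: f - k%:R *: 1)%R.
have cE k x : c k x = (if N%:R * f x - k%:R <= 0 then 0 else
    if N%:R * f x - k%:R <= 1 then N%:R * f x - k%:R else 1)%R.
  by rewrite clampE !ctsE mulr1.
have cV k : below (V k) (c k).
  split=> x; rewrite cE.
    by case: ifPn => [_|]; [rewrite lexx ler01|case: ifPn; rewrite -?ltNge => h1 h2;
      apply/andP; split; lra].
  by rewrite /V /= ctsE => /negP; rewrite -leNgt subr_le0 => ->.
have NfE : (N%:R *: f = \sum_(k < N) c k)%R.
  apply: ctsP => x; have /andP[f0 f1] := f01 x; rewrite cts_sumE.
  under eq_bigr do rewrite cE; rewrite clamp_sum ?mulr_ge0// ctsE min_l//.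
  by rewrite ler_piMr.
have VI : \sum_(k < N) P (V k) <= (N%:R * J + 1)%:E.
  have -> : (N%:R * J + 1)%:E = \int[P]_x ((N%:R *: f + 1 *: 1)%R x)%:E.
    by rewrite cts_integral_linear// cts_integral_cst// -(fineK fI) -EFinM -EFinD.
  have mV k : measurable (V k : set (borel X)) by exact: borel_open.
  have -> : \sum_(k < N) P (V k) =
      \int[P]_x \sum_(k < N) ((\1_(V k) : borel X -> R) x)%:E.
    rewrite ge0_integral_sum//.
    - by apply: eq_bigr => k _; rewrite integral_indic// setIT.
    - move=> k; apply/measurable_EFinP; exact: measurable_indic.
  apply: ge0_le_integral => //.
  - by move=> x _; apply: sume_ge0 => k _; rewrite lee_fin.
  - by apply: emeasurable_sum => k; apply/measurable_EFinP; exact: measurable_indic.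
  - by apply/measurable_EFinP; exact: cts_measurable.
  move=> x _; have /andP[f0 f1] := f01 x; rewrite sumEFin lee_fin !ctsE mulr1.
  have t0 : (0 <= N%:R * f x + 1)%R by rewrite addr_ge0// mulr_ge0.
  apply: (@le_trans _ _ (Num.min (N%:R * f x + 1)%R N%:R)); last by rewrite ge_min lexx.
  rewrite -clamp_sum//; apply: ler_sum => k _; rewrite indicE.
  have [|] := boolP (x \in V k); rewrite ?inE ?notin_setE /V /= ctsE => h.
    by rewrite !ifF//; apply/negbTE; rewrite -ltNge; lra.
  case: ifPn => [//|]; rewrite -ltNge => h1; case: ifPn => [_|_]; last exact: ler01.
  exact: ltW.
rewrite -lee_fin; apply: le_trans VI.
have -> : (N%:R * Lam f)%R = Lam (N%:R *: f)%R by rewrite linearZ.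
rewrite NfE linear_sum -sumEFin; apply: lee_sum => k _.
rewrite PE riesz_outer_open//; exact: le_open_content.
Qed.

(** One inequality suffices, applied to [f] and to [- f]; an affine change of scale reduces it to
    values in [[0, 1]]. *)
Lemma riesz_integral f : (Lam f)%:E = \int[P]_x (f x)%:E.
Proof.
have le g : (Lam g)%:E <= \int[P]_x (g x)%:E.
  have [b b0 gb] := cts_bounded cptX g.
  have b1 : (0 < 2 * b + 1)%R by lra.
  have gI : \int[P]_x (g x)%:E \is a fin_num.
    by apply: integrable_fin_num => //; exact: cts_integrable.
  have [g' g'E g'x] : exists2 g' : C(X, R), g = ((2 * b + 1) *: g' + (- b) *: 1)%R &
      forall x, g' x = ((g x + b) / (2 * b + 1))%R.
    exists ((2 * b + 1)^-1 *: (g + b *: 1))%R => [|x].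
      by rewrite scalerA mulfV ?gt_eqF// scale1r scaleNr addrK.
    by rewrite !ctsE mulr1 mulrC.
  have -> : (Lam g = (2 * b + 1) * Lam g' - b)%R.
    by rewrite g'E linearP (state_cst _ Lams).
  have -> : \int[P]_x (g x)%:E = (2 * b + 1)%:E * \int[P]_x (g' x)%:E + (- b)%:E.
    by rewrite g'E cts_integral_linear// cts_integral_cst.
  rewrite EFinD leeD2r// EFinM lee_wpmul2l ?lee_fin ?(ltW b1)//.
  apply: riesz_integral_ge01 => x; rewrite g'x.
  have := gb x; rewrite ler_norml => /andP[g1 g2]; apply/andP; split.
    by rewrite divr_ge0 ?(ltW b1)//; lra.
  by rewrite ler_pdivrMr//; lra.
apply/eqP; rewrite eq_le le/=.
have fI : \int[P]_x (f x)%:E \is a fin_num.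
  by apply: integrable_fin_num => //; exact: cts_integrable.
have := le (- f)%R; rewrite linearN /= (_ : \int[P]_x ((- f)%R x)%:E = - \int[P]_x (f x)%:E).
  by rewrite -(fineK fI) -EFinN !lee_fin lerN2.
have fN : (-1 *: f + 0 *: 1 = - f)%R by rewrite scaleN1r scale0r addr0.
by rewrite -fN cts_integral_linear// cts_integral_cst// adde0 mulN1e.
Qed.

Lemma riesz_represents : represents P Lam.
Proof. by split; [exact: riesz_regular|exact: riesz_integral]. Qed.

End riesz_representation.

(** * The integral of [ln psi] as the infimum of [mu phi] over [psi <= cexp phi] *)

Section integral_ln.
Variables (X : ptopologicalType) (R : realType).
Hypotheses (cptX : compact [set: X]) (hX : hausdorff_space X).
Variable mu : {scalar C(X, R)}.
Hypothesis mus : states mu.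
Variable psi : C(X, R).
Hypothesis hpsi : nonneg psi.

Lemma riesz_measureP : represents (riesz_measure mu) mu.
Proof.
have [P PE] := exists_riesz_probability cptX hX mus.
have /getPex // : exists P, [set P | represents P mu] P.
by exists P; exact: riesz_represents.
Qed.

Lemma integral_ln_le phi : (forall x, psi x <= cexp phi x) ->
  (integral_ln psi mu <= (mu phi)%:E)%E.
Proof. by move=> pphi; rewrite riesz_measureP.2; exact: integral_lne_le. Qed.

Lemma integral_ln_ge (b : R) :
  (forall phi, (forall x, psi x <= cexp phi x) -> b <= mu phi) ->
  (b%:E <= integral_ln psi mu)%E.
Proof.
move=> bphi; apply: integral_lne_ge => // phi pphi.
by rewrite -riesz_measureP.2 lee_fin bphi.
Qed.

End integral_ln.

(** * Variational principle *)

Section variational_principle.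
Variables (X : ptopologicalType) (R : realType).
Hypotheses (cptX : compact [set: X]) (hX : hausdorff_space X).
Variables (delta : {lrmorphism C(X, R) -> C(X, R)}).
Variables (A : {linear C(X, R) -> C(X, R)}).
Hypothesis hA : transfer_operator delta A.
Variable psi : C(X, R).
Hypothesis hpsi : nonneg psi.

Local Open Scope ereal_scope.

(** The spectral radius is an infimum, so each [n] is treated separately. With [cexp phi = psi + e],
    the bound [mu phi] on the integral cancels the [- mu phi] in the bound on the t-entropy. *)
Lemma variational_upper_bound (mu : {scalar C(X, R)}) : invariant_states delta mu ->
  integral_ln psi mu + t_entropy A mu <= log_spectral_radius (weighted A psi).
Proof.
move=> mui; have [s [sub _ s0 ->]] := exists_spectral_sequence cptX hA hpsi.
apply: le_ereal_inf_tmp => _ [n n0 <-]; rewrite /mkset in n0.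
have n1 : (0 < (n%:R : R))%R by rewrite ltr0n.
set v := (X in X <= _).
have vc (c : R) : (s n < expR c)%R -> v <= (n%:R^-1 * c)%:E.
  move=> snc; have [K K0 KP] := weight_perturb cptX delta hpsi n.
  have [b b1 bP] := iter_transfer_bounded cptX A n.
  (* The gap between [s n] and [expR c] pays for the perturbation, which raises [A^n psi_n] by at
     most [e * K * b]. *)
  pose e := Num.min 1%R ((expR c - s n) / (K * b + 1))%R.
  have Kb : (0 < K * b + 1)%R by rewrite ltr_wpDl// mulr_ge0// (le_trans _ b1).
  have e0 : (0 < e)%R by rewrite lt_min ltr01 divr_gt0// subr_gt0.
  have [|phi phiE] := @exists_cln X R (psi + e *: 1)%R.
    by move=> x; rewrite !ctsE mulr1 ltr_wpDl.
  have Aphi x : (iter n A (weight delta (cexp phi) n) x <= expR c)%R.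
    rewrite phiE.
    apply: (@le_trans _ _ (iter n A (weight delta psi n + (e * K) *: 1)%R x)).
      apply: (iter_transfer_le hA) => y; rewrite !ctsE mulr1; apply: KP.
      by rewrite (ltW e0) ge_min lexx.
    rewrite linearD linearZ /= !ctsE.
    apply: (@le_trans _ _ (s n + e * (K * b + 1))%R).
      apply: lerD; first exact: sub.
      rewrite -mulrA ler_wpM2l ?(ltW e0)//.
      by rewrite (@le_trans _ _ (K * b)%R) ?lerDl// ler_wpM2l// bP.
    rewrite -lerBrDl -ler_pdivlMr//; by rewrite ge_min lexx orbT.
  have int_le : integral_ln psi mu <= (mu phi)%:E.
    apply: integral_ln_le => //; first exact: mui.1.
    by move=> x; rewrite phiE !ctsE mulr1 lerDl ltW.
  apply: le_trans (leeD int_le (t_entropy_le cptX hA mui n0 Aphi)) _.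
  by rewrite -EFinD addrC subrK.
(* If [s n = 0], every real [c] is admissible in [vc], so [v] is [-oo]. *)
have := s0 n; rewrite le_eqVlt => /predU1P[sn|sn].
  rewrite -sn le0_lneNy// mulrNy gtr0_sg ?invr_gt0// mul1e leeNy_eq.
  apply/eqP/eq_ninfty => r; apply: le_trans (vc (n%:R * r)%R _) _.
    by rewrite -sn expR_gt0.
  by rewrite mulKf ?gt_eqF.
rewrite lne_EFin// -EFinM; apply/lee_addgt0Pr => e e0.
apply: le_trans (vc (ln (s n) + n%:R * e)%R _) _.
  by rewrite expRD lnK ?posrE// ltr_pMr// expR_gt1 mulr_gt0.
by rewrite mulrDr mulKf ?gt_eqF.
Qed.

(** For finite [l(psi)], the equilibrium state satisfies [L - mu phi <= t_entropy A mu] for all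
    admissible [phi]; the infimum of [mu phi] over these is the integral of [ln psi]. *)
Lemma exists_maximal_state : exists2 mu, invariant_states delta mu &
  log_spectral_radius (weighted A psi) <= integral_ln psi mu + t_entropy A mu.
Proof.
have [mu mui muP] := exists_equilibrium_state cptX hA hpsi.
exists mu => //; have [s [_ sE s0 ->]] := exists_spectral_sequence cptX hA hpsi.
set S := [set _ | _ in _].
have Sle n : (0 < n)%N -> ereal_inf S <= (n%:R^-1)%:E * lne (s n)%:E.
  by move=> n0; apply: ereal_inf_lbound; exists n.
case SL : (ereal_inf S) => [L| |]; last exact: leNye; last first.
  have := Sle 1%N isT; rewrite SL leye_eq invr1 mul1e => /eqP h.
  have : lne (s 1%N)%:E <= (ln (s 1%N + 1))%:E.
    by rewrite lne_le// lnK ?posrE ?ltr_wpDl// lerDl.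
  by rewrite h leye_eq.
have sL N : (0 < N)%N -> exists x, (expR (N%:R * L) <= iter N A (weight delta psi N) x)%R.
  move=> N0; have [x xE] := sE N; exists x; rewrite xE.
  have N1 : (0 < (N%:R : R))%R by rewrite ltr0n.
  have := Sle N N0; rewrite SL.
  have := s0 N; rewrite le_eqVlt => /predU1P[<-|sN].
    by rewrite le0_lneNy// mulrNy gtr0_sg ?invr_gt0// mul1e leeNy_eq.
  rewrite lne_EFin// -EFinM lee_fin mulrC ler_pdivlMr// mulrC => h.
  by rewrite -[leRHS](@lnK _ (s N)) ?posrE// ler_expR.
have tau_ge phi : (forall x, psi x <= cexp phi x)%R ->
    (L - mu phi)%:E <= t_entropy A mu.
  move=> pphi; apply: (le_t_entropy cptX hA mui.1) => n theta n0 t1.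
  apply: le_trans (muP L sL phi pphi n theta n0 t1) _.
  by rewrite le_eqVlt; apply/orP; left; apply/eqP; ring.
(* The choice [phi1 = ln (psi + 1)] bounds the t-entropy on both sides, so that it is finite and can
   be moved across the inequality. *)
have [phi1 phi1E] : exists phi, cexp phi = (psi + 1)%R.
  by apply: exists_cln => x; rewrite !ctsE ltr_wpDl.
have [b b0 bP] := cts_bounded cptX (iter 1 A (weight delta (cexp phi1) 1)).
have tau_le : t_entropy A mu <= (1%:R^-1 * ln (b + 1) - mu phi1)%:E.
  apply: (@t_entropy_le X R cptX delta A hA mu 1 phi1 (ln (b + 1))) => // x.
  rewrite lnK ?posrE ?ltr_wpDl//; apply: le_trans (ler_norm _) _.
  by apply: le_trans (bP x) _; rewrite lerDl.
have tfin : t_entropy A mu \is a fin_num.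
  rewrite fin_numElt (le_lt_trans tau_le) ?ltry// andbT.
  apply: lt_le_trans (tau_ge phi1 _); first exact: ltNyr.
  by move=> x; rewrite phi1E !ctsE lerDl.
set t := fine (t_entropy A mu).
have tE : t_entropy A mu = t%:E by rewrite fineK.
have int_ge : (L - t)%:E <= integral_ln psi mu.
  apply: integral_ln_ge => //; first exact: mui.1.
  by move=> phi /tau_ge; rewrite tE lee_fin; lra.
by have := leeD int_ge (lexx t%:E); rewrite -EFinD subrK tE.
Qed.

End variational_principle.

Theorem theorem11p2 (R : realType) (X : ptopologicalType)
  (cptX : compact [set: X]) (hX : hausdorff_space X)
  (delta : {lrmorphism C(X, R) -> C(X, R)})
  (A : {linear C(X, R) -> C(X, R)})
  (hA : transfer_operator delta A)
  (psi : C(X, R)) (hpsi : nonneg psi) :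
  is_max [set integral_ln psi mu + t_entropy A mu
           | mu in invariant_states delta]%E
         (log_spectral_radius (weighted A psi)).
Proof.
have ub mu : invariant_states delta mu ->
    (integral_ln psi mu + t_entropy A mu <= log_spectral_radius (weighted A psi))%E.
  exact: variational_upper_bound.
split; last by move=> _ [mu mui <-]; exact: ub.
have [mu mui le] := exists_maximal_state cptX hX hA hpsi.
by exists mu => //; apply/eqP; rewrite eq_le ub.
Qed.
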